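(* Let $M>0$ and $q\in[0,1]$ be such that $2M\ge q$. Then the problem $$\min_{u\in\mathcal K^M_q}\int_{-1}^1\frac{dx}{1+u'(x)^2}$$ has a unique solution $u_{M;q}$. If $M\in[1,+\infty)$, it is given by $u_{M;q}(x)=M(1-|x|)$ for $x\in[-1,1]$. If $M\in(0,1)$, it is given by $$u_{M;q}(x)=\begin{cases}\dfrac q2\,(x^2-\gamma_{M;q}^2)+M & \text{if } |x|\le\gamma_{M;q},\\[2mm] \dfrac{M}{1-\gamma_{M;q}}\,(1-|x|) & \text{if } \gamma_{M;q}\le|x|\le 1,\end{cases}$$ where $\gamma_{M;q}\in(0,1)$ is the unique minimizer over $[0,1]$ of the function $R_{M;q}:[0,1]\to\mathbb R$ defined by $$R_{M;q}(\gamma)=\begin{cases}\dfrac2q\arctan(q\gamma)+\dfrac{2(1-\gamma)^3}{M^2+(1-\gamma)^2} & \text{if } q>0,\\[2mm] 2\gamma+\dfrac{2(1-\gamma)^3}{M^2+(1-\gamma)^2} & \text{if } q=0.\end{cases}$$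
   Context: For $q\ge0$, a function $u:[-1,1]\to\mathbb R$ is called $q$-concave on $[-1,1]$ if $x\mapsto u(x)-\frac q2x^2$ is concave on $[-1,1]$. For $M>0$, $\mathcal K^M_q$ denotes the set of all functions $u:[-1,1]\to[0,M]$ that are $q$-concave on $[-1,1]$. Such functions are differentiable almost everywhere and $u'$ denotes the a.e. derivative. *)

(* Defs.v *)
From HB Require Import structures.
From mathcomp Require Import all_boot all_order all_algebra.
From mathcomp Require Import all_classical all_reals all_analysis.

Set Implicit Arguments.
Unset Strict Implicit.
Unset Printing Implicit Defensive.

Import Order.TTheory GRing.Theory Num.Theory.
Import numFieldNormedType.Exports.

Local Open Scope classical_set_scope.
Local Open Scope ring_scope.

Definition minimizer (T : Type) (d : Order.disp_t) (S : porderType d)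
    (A : set T) (f : T -> S) (x : T) : Prop :=
  A x /\ forall y, A y -> (f x <= f y)%O.

Definition concave_function (R : realType) (D : set R) (f : R -> R) : Prop :=
  @convex_function R R^o D (fun x => - f x).

Definition q_concave (R : realType) (q : R) (u : R -> R) : Prop :=
  concave_function `[-1, 1] (fun x => u x - q / 2 * x ^+ 2).

(* A function u : [-1,1] -> [0,M] is represented by any u : R -> R whose
   restriction to [-1,1] is the given function; values outside [-1,1] are
   unconstrained, so equality of such functions means equality on [-1,1]. *)
Definition K (R : realType) (M q : R) : set (R -> R) :=
  [set u | (forall x, -1 <= x <= 1 -> 0 <= u x <= M) /\ q_concave q u].

(* derive1 u is a total function, equal to the derivative of u at every interior
   point of [-1,1] where u is differentiable. For u in K M q the remaining
   points (including -1 and 1, where it may depend on values of u outside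
   [-1,1]) form a countable set, so the integral is the one of the a.e.
   derivative. *)
Definition resistance (R : realType) (u : R -> R) : \bar R :=
  (\int[lebesgue_measure]_(x in `[(-1)%R, 1%R]) ((1 + (derive1 u x) ^+ 2)^-1)%R%:E)%E.

Definition Rfun (R : realType) (M q gamma : R) : R :=
  (if 0 < q then 2 / q * atan (q * gamma) else 2 * gamma)
  + 2 * (1 - gamma) ^+ 3 / (M ^+ 2 + (1 - gamma) ^+ 2).

(* Main.v *)
Require Import Defs.
From HB Require Import structures.
From mathcomp Require Import all_boot all_order all_algebra.
From mathcomp Require Import all_classical all_reals all_analysis.
From mathcomp Require Import ring lra measurable_realfun.

Set Implicit Arguments.
Unset Strict Implicit.
Unset Printing Implicit Defensive.

Import Order.TTheory GRing.Theory Num.Theory.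
Import numFieldNormedType.Exports.

Local Open Scope classical_set_scope.
Local Open Scope ring_scope.

(* Write [f t = 1 / (1 + t^2)]. Let [u] be in K and let [p] be its slope, so
   that [p x - q x] is nonincreasing. Let V be the set of points at which [u]
   is smaller than somewhere to the left and somewhere to the right, and put
   [|V| = 2 G]. Off V, [u] is unimodal, so [|p|] integrates there to at most
   [2 M]; the tangent to [f] at a slope [t >= 1] lies below [f] on [0, +oo[, and
   bounds the cost of that part from below. In V, a point with slope [s] in
   absolute value comes with an interval inside V of length [2 s / q] with
   smaller slopes, because slopes increase at rate at most [q]; hence [|p|] on V
   is stochastically dominated by the slopes of one parabola of width [2 G],
   which gives [2 / q * atan (q G)] for the cost of V. For [G >= 1 - M] the sum
   is [R G] when the tangent is taken at [t = M / (1 - G)], and for smaller [G]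
   it is at least [R (1 - M)] when [t = 1]. The derivative of [R] has the sign
   of a polynomial that is strictly increasing on [max(0, 1 - M), 1], whence the
   unique minimizer. In the equality case [|p|] is a.e. 0 or the optimal slope
   off V; as slopes cannot cross a forbidden range upwards, ]-1, 1[ splits into
   three consecutive intervals (steep up, V, steep down), the height bound [M]
   fixes their lengths, and an extremal slope in V forces the parabola. *)

(** * Bisection and layer cake *)

(** Two things stand in the way. [f] is not convex: its tangent at [t >= 0] stays below it on [0,
    +oo[ only if [t >= 1], and the tangent at 1 touches [f] at 0 as well. And [u] may oscillate, so
    its variation is not controlled by [M]; V collects the oscillations, and there only the growth
    bound on slopes is available. The value [1 - M] is the half-width for which the side slope
    [M / (1 - g)] equals 1. All arguments run on a supergradient selection [p], which exists at
    every interior point and agrees with [u'] off a countable set. It may be unbounded near -1 and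
    1, so [|p|] is integrated over inner intervals only. The condition [q <= 1] makes the polynomial
    increasing, and it gives [q * g < 1 <= t], which separates the slopes of the parabola from the
    slope of the sides. The condition [q <= 2 * M] keeps the parabola nonnegative. For [q = 0] the
    valley is empty and a plateau counts as part of its complement; slopes 0 and 1 then lie on one
    tangent, so the equality case has two alternatives. *)

Section halving.
Context {R : realType}.

(* Bisecting ]a, b[ halves the sum of the upper bounds, because the increments
   of [W] telescope. *)
Lemma halving_le0 (Phi : R -> R -> R) (W : R -> R) (a b : R) : a <= b ->
  (forall x y z, a <= x -> x <= y -> y <= z -> z <= b ->
     Phi x z <= Phi x y + Phi y z) ->
  (forall x y, a <= x -> x <= y -> y <= b -> Phi x y <= (y - x) * (W x - W y)) ->
  Phi a b <= 0.
Proof.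
move=> ab subadd le0.
have H n x y : a <= x -> x <= y -> y <= b ->
    Phi x y <= (y - x) * (W x - W y) / 2 ^+ n.
  elim: n x y => [|n IH] x y ax xy yb; first by rewrite expr0 divr1 le0.
  have xm : x <= (x + y) / 2 by lra.
  have my : (x + y) / 2 <= y by lra.
  apply: le_trans (subadd _ _ _ ax xm my yb) _.
  apply: le_trans (lerD (IH _ _ ax xm (le_trans my yb)) (IH _ _ (le_trans ax xm) my yb)) _.
  have -> : (2 : R) ^- n.+1 = 2 ^- n / 2 by rewrite exprS invfM mulrC.
  by rewrite le_eqVlt; apply/orP; left; apply/eqP; field; rewrite expf_neq0.
rewrite leNgt; apply/negP => Pab.
set C := (b - a) * (W a - W b) in H *.
have [n] : exists n, C / Phi a b < n%:R.
  exists (Num.bound `|C / Phi a b|); apply: le_lt_trans (ler_norm _) _.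
  by rewrite archi_boundP.
rewrite ltr_pdivrMr// => Cn.
have := H n a b (lexx _) ab (lexx _); rewrite ler_pdivlMr ?exprn_gt0// -/C.
apply/negP; rewrite -ltNge; apply: lt_trans Cn _.
by rewrite mulrC ltr_pM2l// -natrX ltr_nat ltn_expl.
Qed.

End halving.

Section measure.
Context {R : realType}.
Local Notation mu := (@lebesgue_measure R).

Lemma nonincreasing_measurable_itv (D : set R) (f : R -> R) : is_interval D ->
  (forall x y, D x -> D y -> x <= y -> f y <= f x) -> measurable_fun D f.
Proof.
move=> iD fD.
apply: (measurability (@RGenCInfty.G R)) => [|/= _ [_] [r] -> <-].
  exact: RGenCInfty.measurableE.
apply: is_interval_measurable => s t /= [Ds +] [Dt +] z szt.
rewrite !in_itv/= !andbT => fs ft; have Dz : D z by exact: iD szt.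
by case/andP: szt => sz zt; split => //; apply: le_trans ft _; apply: fD.
Qed.

(** Tonelli for the indicator of the region under the graph: the vertical sections have length
    [X x], the horizontal ones are superlevel sets. *)
Lemma layer_cake (X : R -> R) : measurable_fun setT X -> (forall x, 0 <= X x) ->
  let P := [set z : R * R | 0 <= z.2 < X z.1] in
  measurable P /\
  (\int[mu]_x (X x)%:E = \int[mu]_r (mu (ysection P r)))%E.
Proof.
move=> mX X0 P.
have mP : measurable P.
  pose g1 (z : R * R) := (0 <= z.2)%R.
  pose g2 (z : R * R) := (z.2 < X z.1)%R.
  rewrite (_ : P = g1 @^-1` [set true] `&` g2 @^-1` [set true]); last first.
    by apply/seteqP; split => z /=; rewrite /P /g1 /g2 /= => /andP.
  apply: measurableI.
  - have : measurable_fun setT g1 by exact: measurable_fun_ler.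
    by move=> /(_ measurableT [set true]); rewrite setTI; exact.
  - have : measurable_fun setT g2.
      by apply: measurable_fun_ltr => //; exact: measurableT_comp.
    by move=> /(_ measurableT [set true]); rewrite setTI; exact.
split => //.
have := @indic_fubini_tonelli _ _ _ _ R mu mu P mP.
rewrite indic_fubini_tonelli_FE// indic_fubini_tonelli_GE//= => <-.
apply: eq_integral => x _ /=.
rewrite (_ : xsection P x = `[0, X x[%classic); last first.
  by apply/seteqP; split => y /=; rewrite /xsection /= inE /P /= in_itv.
by rewrite lebesgue_measure_itv/= lte_fin; case: ltgtP (X0 x) => //[_|<-] _; rewrite ?sube0// subr0.
Qed.

(** Stochastic domination. The two functions live on different sets, so only their tails can be
    compared, not their values. *)
Lemma tail_le_integral (A B : set R) (X Y : R -> R) :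
  measurable A -> measurable B ->
  measurable_fun A X -> measurable_fun B Y ->
  (forall x, A x -> 0 <= X x) -> (forall x, B x -> 0 <= Y x) ->
  (forall r, 0 <= r ->
    (mu (B `&` [set x | r < Y x]%R) <= mu (A `&` [set x | r < X x]%R))%E) ->
  (\int[mu]_(x in B) (Y x)%:E <= \int[mu]_(x in A) (X x)%:E)%E.
Proof.
move=> mA mB mX mY X0 Y0 XY.
(* [Z] is extended by 0 outside [C]; a level [r >= 0] is never exceeded there, so the superlevel
   sets do not change. *)
have aux (C : set R) (Z : R -> R) (mC : measurable C) (mZ : measurable_fun C Z)
    (Z0 : forall x, C x -> 0 <= Z x) : exists P : set (R * R),
   [/\ measurable P, (\int[mu]_(x in C) (Z x)%:E = \int[mu]_r (mu (ysection P r)))%E,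
    (forall r, 0 <= r -> ysection P r = C `&` [set x | r < Z x])
    & forall r, r < 0 -> ysection P r = set0].
  have mZC : measurable_fun setT (Z \_ C) by apply/(measurable_restrictT _ _).1.
  have ZC0 x : 0 <= (Z \_ C) x.
    by rewrite patchE; case: ifPn => // /set_mem /Z0.
  have [mP eP] := layer_cake mZC ZC0.
  exists [set z : R * R | 0 <= z.2 < (Z \_ C) z.1]; split => //.
  - rewrite -eP integral_mkcond; apply: eq_integral => x _.
    by rewrite !patchE; case: ifPn.
  - move=> r r0; apply/seteqP; split => x /=; rewrite /ysection/= inE/= patchE r0 /=.
      case: ifPn => [/set_mem //|_]; by rewrite ltNge r0.
    by move=> [Cx rZ]; rewrite mem_set.
  - move=> r r0; apply/seteqP; split => x //=; rewrite /ysection/= inE/=.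
    by rewrite leNgt r0.
have [P [mP -> P1 P2]] := aux _ _ mA mX X0.
have [Q [mQ -> Q1 Q2]] := aux _ _ mB mY Y0.
apply: ge0_le_integral => //.
- exact: measurable_fun_ysection.
- exact: measurable_fun_ysection.
- move=> r _; have [r0|r0] := leP 0 r; first by rewrite P1// Q1// XY.
  by rewrite P2// Q2.
Qed.

End measure.

(** * Slopes of q-concave functions *)

(** The function [f] of the overview. *)
Definition drag {R : realType} (t : R) : R := (1 + t ^+ 2)^-1.

(* [p x - q * x] is a supergradient at [x] of the function [u - q / 2 * x^2]. *)
Definition slope_sel {R : realType} (q : R) (u p : R -> R) :=
  forall x y : R, -1 < x < 1 -> -1 <= y <= 1 ->
    u y <= u x + p x * (y - x) + q / 2 * (y - x) ^+ 2.

Definition oo11 {R : realType} : set R := `]-1, 1[%classic.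

Section selection.
Context {R : realType}.
Implicit Types (q : R) (u p : R -> R).

(** Concavity of [u - q / 2 * x^2] with weight [(y - x) / (y - z)], the denominators cleared. *)
Lemma q_concave_chord q u z x y : q_concave q u ->
  -1 <= z -> z < x -> x < y -> y <= 1 ->
  (y - x) * (u z - q / 2 * z ^+ 2) + (x - z) * (u y - q / 2 * y ^+ 2)
  <= (y - z) * (u x - q / 2 * x ^+ 2).
Proof.
move=> cu z1 zx xy y1.
have yz : 0 < y - z by lra.
have t0 : 0 <= (y - x) / (y - z) by rewrite divr_ge0//; lra.
have t1 : (y - x) / (y - z) <= 1 by rewrite ler_pdivrMr//; lra.
have z11 : z \in `[(-1 : R), 1]%classic by rewrite inE/= in_itv/= z1/=; lra.
have y11 : y \in `[(-1 : R), 1]%classic by rewrite inE/= in_itv/= y1 andbT; lra.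
pose t := (y - x) / (y - z).
have : - (u (t * z + (1 - t) * y) - q / 2 * (t * z + (1 - t) * y) ^+ 2)
  <= t * - (u z - q / 2 * z ^+ 2) + (1 - t) * - (u y - q / 2 * y ^+ 2).
  exact: (cu (Itv01 t0 t1) z y z11 y11).
have tE : t * (y - z) = y - x by rewrite /t divfK// gt_eqF.
have -> : t * z + (1 - t) * y = x by rewrite (_ : _ + _ = y - t * (y - z)); [rewrite tE|]; ring.
set vx := u x - _; set vz := u z - _; set vy := u y - _ => H.
have {}H : t * vz + (1 - t) * vy <= vx by lra.
have : (y - z) * (t * vz + (1 - t) * vy) <= (y - z) * vx by rewrite ler_pM2l.
suff -> : (y - z) * (t * vz + (1 - t) * vy) = (y - x) * vz + (x - z) * vy by [].
by rewrite -tE (_ : x = y - t * (y - z)); [|rewrite tE]; ring.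
Qed.

Lemma slope_sel_exists q u : q_concave q u -> exists p, slope_sel q u p.
Proof.
move=> cu; pose v x := u x - q / 2 * x ^+ 2.
(* For concave [v] the supremum of the chord slopes to the right of [x] is the right derivative. Any
   chord slope to the left bounds it from above ([Sub]), which needs [x] to be interior. *)
pose S x := [set (v y - v x) / (y - x) | y in [set y | x < y <= 1]].
have Sub x z : -1 <= z -> z < x -> ubound (S x) ((v x - v z) / (x - z)).
  move=> z1 zx _ [y /= /andP[xy y1] <-].
  have := q_concave_chord cu z1 zx xy y1; rewrite -/(v x) -/(v y) -/(v z) => H.
  rewrite ler_pdivrMr ?subr_gt0// mulrAC ler_pdivlMr ?subr_gt0//; nra.
have S0 x : x < 1 -> S x !=set0 by move=> x1; exists ((v 1 - v x) / (1 - x)); exists 1 => //=; rewrite x1 lexx.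
exists (fun x => sup (S x) + q * x) => x y /andP[x1 x2] /andP[y1 y2].
suff : v y - v x <= sup (S x) * (y - x).
  rewrite /v => H; rewrite -subr_ge0; move: H; rewrite -subr_ge0; set s := sup _.
  by congr (_ <= _); field.
case: (ltgtP x y) => [xy|yx|->]; last by rewrite !subrr mulr0.
  rewrite -ler_pdivrMr ?subr_gt0//; apply: ub_le_sup.
    by exists ((v x - v (-1)) / (x - -1)); apply: Sub.
  by exists y => //=; rewrite xy.
have : sup (S x) <= (v x - v y) / (x - y) by apply: ge_sup; [exact: S0|exact: Sub].
by rewrite ler_pdivlMr ?subr_gt0//; lra.
Qed.

(** Take the supergradient at the intermediate point: in the weighted sum of its inequalities
    towards [x] and [y] the first-order terms cancel. The degenerate weights are set apart because
    the intermediate point must be interior. *)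
Lemma slope_sel_q_concave q u p : slope_sel q u p -> q_concave q u.
Proof.
move=> up.
have key (s x y : R) : 0 < s -> s < 1 -> x != y -> -1 <= x -> x <= 1 -> -1 <= y -> y <= 1 ->
    s * (u x - q / 2 * x ^+ 2) + (1 - s) * (u y - q / 2 * y ^+ 2) <=
    u (s * x + (1 - s) * y) - q / 2 * (s * x + (1 - s) * y) ^+ 2.
  move=> s0 s1 xy x1 x2 y1 y2.
  set z := s * x + (1 - s) * y.
  have z11 : -1 < z < 1.
    by move: xy; rewrite neq_lt /z => /orP[] ?; apply/andP; split; nra.
  have H1 : u x <= u z + p z * (x - z) + q / 2 * (x - z) ^+ 2 by apply: up => //; lra.
  have H2 : u y <= u z + p z * (y - z) + q / 2 * (y - z) ^+ 2 by apply: up => //; lra.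
  have H3 : s * u x <= s * (u z + p z * (x - z) + q / 2 * (x - z) ^+ 2) by rewrite ler_pM2l.
  have H4 : (1 - s) * u y <= (1 - s) * (u z + p z * (y - z) + q / 2 * (y - z) ^+ 2).
    by rewrite ler_pM2l// subr_gt0.
  rewrite -subr_ge0; move: (lerD H3 H4); rewrite -subr_ge0.
  by rewrite (_ : _ - _ = u z - q / 2 * z ^+ 2 - (s * (u x - q / 2 * x ^+ 2) +
    (1 - s) * (u y - q / 2 * y ^+ 2)))// /z; field.
move=> t x y; rewrite !inE/= !in_itv/= => /andP[x1 x2] /andP[y1 y2].
have /(_ isT) := ge0 t; have /(_ isT) := le1 t; set s := t%:num => s1 s0.
suff : s * (u x - q / 2 * x ^+ 2) + (1 - s) * (u y - q / 2 * y ^+ 2) <=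
    u (s * x + (1 - s) * y) - q / 2 * (s * x + (1 - s) * y) ^+ 2.
  by rewrite -lerN2 [leRHS]opprD -(mulrN s) -(mulrN (1 - s)); exact.
have [->|sn0] := eqVneq s 0; first by rewrite !subr0 !mul0r !mul1r !add0r.
have [->|sn1] := eqVneq s 1; first by rewrite !subrr !mul0r !mul1r !addr0.
have [->|xy] := eqVneq x y.
  by rewrite -!mulrDl (addrC s) subrK !mul1r.
by apply: key => //; rewrite lt_neqAle ?(eq_sym 0) ?sn0 ?sn1.
Qed.

End selection.

Section selection_theory.
Context {R : realType}.
Variables (q : R) (u p : R -> R).
Hypotheses (q0 : 0 <= q) (up : slope_sel q u p).

Lemma sel_rate x y : -1 < x -> x <= y -> y < 1 -> p y - p x <= q * (y - x).
Proof.
move=> x1 xy y1; have [->|xny] := eqVneq x y; first by rewrite !subrr mulr0.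
have {}xy : x < y by rewrite lt_neqAle xny.
have x11 : -1 < x < 1 by lra. have y11 : -1 < y < 1 by lra.
have H1 : u y <= u x + p x * (y - x) + q / 2 * (y - x) ^+ 2 by apply: up; lra.
have H2 : u x <= u y + p y * (x - y) + q / 2 * (x - y) ^+ 2 by apply: up; lra.
have H3 : (p y - p x) * (y - x) <= q * (y - x) * (y - x).
  by rewrite -subr_ge0; move: (lerD H1 H2); rewrite -subr_ge0; congr (_ <= _); field.
by move: H3; rewrite ler_pM2r// subr_gt0.
Qed.

Lemma sel_measurable : measurable_fun oo11 p.
Proof.
rewrite (_ : p = (fun x => (p x - q * x) + q * x)); last by apply/funext => x; rewrite subrK.
apply: measurable_funD; last exact: measurable_funM.
apply: nonincreasing_measurable_itv; first exact: interval_is_interval.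
move=> x y /andP[x1 _] /andP[_ y1] xy.
by have := sel_rate x1 xy y1; lra.
Qed.

(* The discontinuities of [p x - q * x]. *)
Definition jumps : set R := [set x | -1 < x < 1 /\ exists r s : R, [/\ r < s,
  forall y, -1 < y -> y < x -> s <= p y - q * y &
  forall y, x < y -> y < 1 -> p y - q * y <= r]].

(** Each jump contains a rational; two jumps with the same rational would contradict each other at
    their midpoint. *)
Lemma jumps_countable : countable jumps.
Proof.
pose J (c : rat) := [set x | -1 < x < 1 /\
  (forall y, -1 < y -> y < x -> ratr c < p y - q * y) /\
  (forall y, x < y -> y < 1 -> p y - q * y < ratr c)].
have : countable (\bigcup_c J c).
  apply: bigcup_countable => [|c _]; first exact: countableP.
  have [->//|/set0P[x Jx]] := eqVneq (J c) set0.
  apply: (@sub_countable _ _ _ [set x]); last exact: countable1.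
  apply: subset_card_le => y Jy /=.
  have H x' y' : J c x' -> J c y' -> ~ (x' < y').
    move=> [/andP[x1 x2] [Jx1 Jx2]] [/andP[y1 y2] [Jy1 Jy2]] xy.
    have m1 : x' < (x' + y') / 2 by lra. have m2 : (x' + y') / 2 < y' by lra.
    have m3 : -1 < (x' + y') / 2 by lra. have m4 : (x' + y') / 2 < 1 by lra.
    by have := lt_trans (Jx2 _ m1 m4) (Jy1 _ m3 m2); rewrite ltxx.
  by case: (ltgtP x y) => // [/H|/H] [].
apply: sub_countable; apply: subset_card_le => x [x11 [r [s [rs Hs Hr]]]].
have [c] := rat_in_itvoo rs; rewrite in_itv/= => /andP[rc cs].
exists c => //; split => //; split => y y1 y2.
  by apply: lt_le_trans cs _; exact: Hs.
by apply: le_lt_trans _ rc; exact: Hr.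
Qed.

Lemma not_jump x e : -1 < x < 1 -> ~ jumps x -> 0 < e ->
  exists2 d : R, 0 < d & forall y, `|y - x| < d ->
    -1 < y < 1 /\ `|p y - p x| < e.
Proof.
move=> x11 Jx e0; have /andP[x1 x2] := x11.
pose e' := e / 2.
have e'0 : 0 < e' by rewrite /e'; lra.
have [y1 [y1l y1r Hy1]] : exists y, [/\ -1 < y, y < x & p y - q * y < p x - q * x + e'].
  apply: contrapT => H; apply: Jx; split => //.
  exists (p x - q * x), (p x - q * x + e'); split; first lra.
    by move=> y yl yr; rewrite leNgt; apply/negP => ?; apply: H; exists y.
  by move=> y xy y1; have := sel_rate x1 (ltW xy) y1; lra.
have [y2 [y2l y2r Hy2]] : exists y, [/\ x < y, y < 1 & p x - q * x - e' < p y - q * y].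
  apply: contrapT => H; apply: Jx; split => //.
  exists (p x - q * x - e'), (p x - q * x); split; first lra.
    by move=> y yl yr; have := sel_rate yl (ltW yr) x2; lra.
  by move=> y yl yr; rewrite leNgt; apply/negP => ?; apply: H; exists y.
pose d := Num.min (Num.min (x - y1) (y2 - x)) (e' / (q + 1)).
have q1 : 0 < q + 1 by rewrite ltr_wpDl.
exists d; first by rewrite /d !lt_min divr_gt0// !subr_gt0 y1r y2l.
move=> y; rewrite /d !lt_min ltr_pdivlMr// => /andP[/andP[d1 d2] d3].
have [z1 z2] : y1 <= y /\ y <= y2.
  by move: d1 d2; rewrite !ltr_norml => /andP[? _] /andP[_ ?]; split; lra.
split; first by lra.
have y1' : y < 1 by lra. have y1'' : -1 < y by lra.
have A1 := sel_rate y1l z1 y1'. have A2 := sel_rate y1'' z2 y2r.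
have : `|q * (y - x)| < e'.
  rewrite normrM ger0_norm//; apply: le_lt_trans d3.
  by rewrite mulrC ler_wpM2l// lerDl.
rewrite !ltr_norml /e' => /andP[B1 B2].
apply/andP; split; rewrite /e' in Hy1 Hy2; nra.
Qed.

(** The supergradient inequalities at [x] and at [h + x] enclose the increment of [u] between
    [p (h + x) * h] and [p x * h], up to [q / 2 * h^2]. *)
Lemma sel_quotient (x e h : R) : -1 < x < 1 -> 0 < e -> h != 0 -> -1 < h + x < 1 ->
  `|p (h + x) - p x| < e / 2 -> `|h| * (q + 1) < e ->
  `|p x - h^-1 * (u (h + x) - u x)| < e.
Proof.
move=> x11 e0 hn0 hx1 pe he.
have H1 : u (h + x) <= u x + p x * (h + x - x) + q / 2 * (h + x - x) ^+ 2.
  by apply: up => //; case/andP: hx1 => ? ?; apply/andP; split; exact: ltW.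
have H2 : u x <= u (h + x) + p (h + x) * (x - (h + x)) + q / 2 * (x - (h + x)) ^+ 2.
  by apply: up => //; case/andP: x11 => ? ?; apply/andP; split; exact: ltW.
have h0 : 0 < `|h| by rewrite normr_gt0.
rewrite -(ltr_pM2r h0) -normrM mulrBl mulrAC mulVf// mul1r.
have Q : q * h ^+ 2 < e * `|h|.
  rewrite -real_normK ?num_real//.
  have : `|h| * (`|h| * (q + 1)) < `|h| * e by rewrite ltr_pM2l.
  have : 0 <= `|h| * `|h| by rewrite mulr_ge0.
  lra.
have : `|(p (h + x) - p x) * h| < e / 2 * `|h| by rewrite normrM ltr_pM2r.
rewrite !ltr_norml => /andP[P1 P2].
by apply/andP; split; lra.
Qed.

Lemma sel_derive1 x : -1 < x < 1 -> ~ jumps x -> derive1 u x = p x.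
Proof.
move=> x11 Jx; rewrite /derive1; apply: cvg_lim => //.
apply/cvgrPdist_lt => e e0.
have e20 : 0 < e / 2 by rewrite divr_gt0.
have [d d0 Hd] := not_jump x11 Jx e20.
have q1 : 0 < q + 1 by rewrite ltr_wpDl.
near=> h.
have hn0 : h != 0 by near: h; exact: nbhs_dnbhs_neq.
have hd : `|h| < d by near: h; apply: dnbhs0_lt.
have he : `|h| < e / (q + 1) by near: h; apply: dnbhs0_lt; rewrite divr_gt0.
have [] := Hd (h + x); first by rewrite addrK.
move=> hx1 pe; apply: sel_quotient => //.
by rewrite -ltr_pdivlMr.
Unshelve. all: by end_near.
Qed.

End selection_theory.

(** * The drag integral of a slope selection *)

Section drag_theory.
Context {R : realType}.
Implicit Types s t : R.

Lemma drag_den_gt0 t : 0 < 1 + t ^+ 2.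
Proof. by rewrite ltr_pwDl// sqr_ge0. Qed.

Lemma drag_gt0 t : 0 < drag t.
Proof. by rewrite /drag invr_gt0 drag_den_gt0. Qed.

Lemma drag_ge0 t : 0 <= drag t.
Proof. exact/ltW/drag_gt0. Qed.

Lemma drag_le1 t : drag t <= 1.
Proof. by rewrite /drag invf_le1 ?drag_den_gt0// lerDl sqr_ge0. Qed.

Lemma dragN t : drag (- t) = drag t.
Proof. by rewrite /drag sqrrN. Qed.

Lemma drag_norm t : drag `|t| = drag t.
Proof. by rewrite /drag real_normK ?num_real. Qed.

Lemma drag_le s t : (drag t <= drag s) = (`|s| <= `|t|).
Proof.
rewrite /drag lef_pV2 ?posrE ?drag_den_gt0// lerD2l.
by rewrite -(real_normK (num_real s)) -(real_normK (num_real t)) ler_pXn2r// nnegrE.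
Qed.

Lemma drag_lt s t : (drag t < drag s) = (`|s| < `|t|).
Proof. by rewrite ltNge drag_le -ltNge. Qed.

Lemma measurable_drag (D : set R) (f : R -> R) : measurable D -> measurable_fun D f ->
  measurable_fun D (drag \o f).
Proof.
move=> mD mf; have cn : continuous (@drag R).
  move=> t; apply: cvgV; first by rewrite gt_eqF// drag_den_gt0.
  by apply: cvgD; [exact: cvg_cst|exact: exprn_continuous].
by apply: measurableT_comp => //; exact: continuous_measurable_fun.
Qed.

End drag_theory.

Section integrals.
Context {R : realType}.
Local Notation mu := (@lebesgue_measure R).

Lemma mu_oo11 : mu oo11 = 2%:E.
Proof.
rewrite lebesgue_measure_itv/= lte_fin ifT; last lra.
by rewrite -EFinB; congr EFin; lra.
Qed.

Lemma mu_sub_oo11 (A : set R) : measurable A -> A `<=` oo11 -> (mu A <= 2%:E)%E.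
Proof.
by move=> mA A11; rewrite -mu_oo11; apply: le_measure; rewrite ?inE//; exact: measurable_itv.
Qed.

Lemma mu_sub_fin (A : set R) : measurable A -> A `<=` oo11 -> mu A \is a fin_num.
Proof.
move=> mA /(mu_sub_oo11 mA) A2; rewrite ge0_fin_numE//.
by apply: le_lt_trans A2 _; rewrite ltry.
Qed.

Lemma bounded_integrable (A : set R) (g : R -> R) (C : R) : measurable A -> A `<=` oo11 ->
  measurable_fun A g -> (forall x, A x -> `|g x| <= C) -> mu.-integrable A (EFin \o g).
Proof.
move=> mA A11 mg gC; apply: measurable_bounded_integrable => //.
  by apply: le_lt_trans (mu_sub_oo11 mA A11) _; rewrite ltry.
by exists C; split; [exact: num_real|move=> y Cy x Ax; apply: le_trans (gC _ Ax) (ltW Cy)].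
Qed.

(** The Borel sets are not complete, so equality almost everywhere would not transfer measurability;
    off a countable set it does, since all subsets of a countable set are Borel. *)
Lemma measurable_cocountable (D N : set R) (f g : R -> R) : measurable D ->
  countable N -> (forall x, D x -> ~ N x -> f x = g x) ->
  measurable_fun D g -> measurable_fun D f.
Proof.
move=> mD cN fg mg _ U mU.
have mC (A : set R) : A `<=` N -> measurable A.
  move=> AN; apply: countable_measurable; first exact: measurable_set1.
  by apply: sub_countable cN; exact: subset_card_le.
rewrite (_ : D `&` f @^-1` U =
  ((D `&` g @^-1` U) `\` N) `|` (D `&` N `&` f @^-1` U)); last first.
  apply/seteqP; split => x /=.
    move=> [Dx Ux]; have [Nx|Nx] := pselect (N x); [by right|left].
    by split => //; split => //; rewrite -fg.
  by case=> [[[Dx Ux] Nx]|[[Dx Nx] Ux]]; split => //; rewrite fg.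
apply: measurableU; last by apply: mC => x [[]].
by apply: measurableD; [exact: mg|exact: mC].
Qed.

End integrals.

Section resistance_selection.
Context {R : realType}.
Local Notation mu := (@lebesgue_measure R).
Variables (q : R) (u p : R -> R).
Hypotheses (q0 : 0 <= q) (up : slope_sel q u p).

Lemma drag_sel_integrable (A : set R) : measurable A -> A `<=` oo11 ->
  mu.-integrable A (EFin \o (drag \o p)).
Proof.
move=> mA A11; apply: (@bounded_integrable _ _ _ 1) => //.
  apply: measurable_drag => //.
  apply: (measurable_funS _ A11 (sel_measurable up)).
  exact: measurable_itv.
by move=> x Ax /=; rewrite ger0_norm ?drag_le1// drag_ge0.
Qed.

Lemma resistance_sel : resistance u = (\int[mu]_(x in oo11) drag (p x))%:E.
Proof.
have moo : measurable (oo11 : set R) by exact: measurable_itv.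
(* The end points are discarded with the jumps, because [derive1 u] may depend there on values of
   [u] outside [-1, 1]. *)
pose N := jumps q p `|` [set -1; 1].
have cN : countable N.
  rewrite /N -bigcup2E; apply: bigcup_countable => // -[|[|i]] _ //=.
  - exact: jumps_countable.
  - exact: finite_set_countable.
have mN : measurable N.
  by apply: countable_measurable => //; exact: measurable_set1.
have N0 : mu N = 0 by exact: countable_lebesgue_measure0.
have up' x : -1 <= x <= 1 -> ~ N x -> oo11 x /\ derive1 u x = p x.
  move=> /andP[x1 x2] /not_orP[Jx /not_orP[xn1 xn2]].
  have x11 : -1 < x < 1.
    by rewrite !lt_neqAle x1 x2 !andbT; apply/andP; split; apply/eqP => //; exact/nesym.
  by split => //; exact: sel_derive1 q0 up _ x11 Jx.
have mp : measurable_fun (`[-1, 1]%classic : set R) (p \_ oo11).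
  by apply: measurable_funTS; apply/(measurable_restrictT _ _).1 => //; exact: sel_measurable up.
have mu' : measurable_fun (`[-1, 1]%classic : set R) (fun x => (1 + (derive1 u x) ^+ 2)^-1).
  apply: (@measurable_cocountable _ _ N _ (drag \o (p \_ oo11))) => //; last exact: measurable_drag.
  move=> x x11 Nx; have [x11' ->] := up' x x11 Nx.
  by rewrite /= patchE mem_set.
rewrite /resistance /Rintegral fineK; last exact/integrable_fin_num/drag_sel_integrable.
transitivity (\int[mu]_(x in `[(-1)%R, 1%R] `\` N) ((1 + (derive1 u x) ^+ 2)^-1)%:E)%E.
  apply: ge0_negligible_integral => //; first exact/measurable_EFinP.
  by move=> x _; rewrite lee_fin; exact: drag_ge0.
transitivity (\int[mu]_(x in oo11 `\` N) (drag (p x))%:E)%E; last first.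
  apply/esym; apply: ge0_negligible_integral => //.
    exact: (measurable_int _ (drag_sel_integrable moo _)).
  by move=> x _; rewrite lee_fin; exact: drag_ge0.
have -> : `[(-1)%R, 1%R] `\` N = oo11 `\` N.
  apply/seteqP; split => x [x11 Nx]; split => //; first by have [] := up' x x11 Nx.
  by case/andP: x11 => ? ?; apply/andP; split; exact: ltW.
apply: eq_integral => x; rewrite inE => -[/andP[x1 x2] Nx].
by have [||_ ->] := up' x => //; apply/andP; split; exact: ltW.
Qed.

End resistance_selection.

(** * Valleys *)

Section shadow_def.
Context {R : realType}.
Implicit Types u : R -> R.

(** The shadow sets of the rising sun lemma, for light from the left and from the right; [valley u]
    is the V of the overview. *)
Definition shadowL u : set R :=
  [set x | -1 < x < 1 /\ exists a, [/\ -1 <= a, a < x & u x < u a]].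

Definition shadowR u : set R :=
  [set x | -1 < x < 1 /\ exists b, [/\ x < b, b <= 1 & u x < u b]].

Definition valley u := shadowL u `&` shadowR u.

Lemma reflect_sel q u p : slope_sel q u p ->
  slope_sel q (u \o -%R) (fun x => - p (- x)).
Proof.
move=> up x y x1 y1 /=.
have := up (- x) (- y); rewrite (_ : -1 < - x < 1); last lra.
rewrite (_ : -1 <= - y <= 1); last lra.
move=> /(_ isT isT); congr (_ <= _); ring.
Qed.

Lemma shadowR_reflect u x : shadowR u x <-> shadowL (u \o -%R) (- x).
Proof.
split=> -[x11 [a [a1 a2 a3]]]; split; try lra; exists (- a).
  by rewrite /= !opprK; split => //; lra.
by move: a3; rewrite /= opprK; split => //; lra.
Qed.

Lemma shadowL_reflect u x : shadowL u x <-> shadowR (u \o -%R) (- x).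
Proof.
split=> -[x11 [a [a1 a2 a3]]]; split; try lra; exists (- a).
  by rewrite /= !opprK; split => //; lra.
by move: a3; rewrite /= opprK; split => //; lra.
Qed.

Lemma valley_reflect u x : valley u x <-> valley (u \o -%R) (- x).
Proof. by rewrite /valley /= shadowR_reflect shadowL_reflect; tauto. Qed.

Lemma valley_sub u : valley u `<=` oo11. Proof. by move=> x [[]]. Qed.

End shadow_def.

Section shadow.
Context {R : realType}.
Variables (q : R).
Hypotheses (q0 : 0 <= q).
Implicit Types (u p : R -> R).

(** The supergradient at [x] alone bounds [u y - u x] by a multiple of [|y - x|]. This one-sided
    control is all that openness of the shadow sets requires. *)
Lemma sel_usc u p x e : slope_sel q u p -> -1 < x < 1 -> 0 < e ->
  exists2 d : R, 0 < d & forall y, `|x - y| < d -> -1 < y < 1 /\ u y < u x + e.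
Proof.
move=> up x11 e0; pose c := `|p x| + q + 1.
have c0 : 0 < c by rewrite ltr_wpDl// addr_ge0.
have ec : 0 < e / c by rewrite divr_gt0.
exists (Num.min (e / c) (Num.min 1 (Num.min (1 - x) (x + 1)))).
  by rewrite !lt_min ec; lra.
move=> y; rewrite !lt_min => /and4P[d1 d2 d3 d4].
have y11 : -1 < y < 1 by move: d3 d4; rewrite !ltr_norml => /andP[? ?] /andP[? ?]; lra.
split => //; apply: le_lt_trans (up x y x11 _) _; first by lra.
rewrite -addrA ltrD2l; move: d1; rewrite ltr_pdivlMr//; apply: le_lt_trans.
rewrite distrC in d2 *; set h := y - x in d2 *.
have h1 : p x * h <= `|p x| * `|h| by rewrite -normrM ler_norm.
have h2 : h ^+ 2 <= `|h|.
  by rewrite -(real_normK (num_real h)) expr2 ler_piMr// ltW.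
have h3 : q / 2 * h ^+ 2 <= q * `|h|.
  apply: ler_pM => //; [by rewrite divr_ge0|exact: sqr_ge0|have := q0; lra].
rewrite /c; have := normr_ge0 h; lra.
Qed.

Lemma shadowL_open u p : slope_sel q u p -> open (shadowL u).
Proof.
move=> up; rewrite openE => x [x11 [a [a1 a2 a3]]].
have e0 : 0 < u a - u x by rewrite subr_gt0.
have [d d0 Hd] := sel_usc up x11 e0.
have dx : 0 < Num.min d (x - a) by rewrite lt_min d0 subr_gt0.
apply/nbhs_ballP; exists (Num.min d (x - a)) => //= y.
rewrite -ball_normE /= lt_min => /andP[xyd xya].
have [y11 uy] := Hd y xyd; split => //.
exists a; split => //; first by move: xya; rewrite ltr_norml => /andP[? ?]; lra.
by lra.
Qed.

Lemma shadowR_open u p : slope_sel q u p -> open (shadowR u).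
Proof.
move=> up; rewrite openE => x [x11 [a [a1 a2 a3]]].
have e0 : 0 < u a - u x by rewrite subr_gt0.
have [d d0 Hd] := sel_usc up x11 e0.
have dx : 0 < Num.min d (a - x) by rewrite lt_min d0 subr_gt0.
apply/nbhs_ballP; exists (Num.min d (a - x)) => //= y.
rewrite -ball_normE /= lt_min => /andP[xyd xya].
have [y11 uy] := Hd y xyd; split => //.
exists a; split => //; first by move: xya; rewrite ltr_norml => /andP[? ?]; lra.
by lra.
Qed.

Lemma measurable_shadowL u p : slope_sel q u p -> measurable (shadowL u).
Proof. by move=> up; apply: open_measurable; exact: shadowL_open up. Qed.

Lemma measurable_shadowR u p : slope_sel q u p -> measurable (shadowR u).
Proof. by move=> up; apply: open_measurable; exact: shadowR_open up. Qed.

Lemma measurable_valley u p : slope_sel q u p -> measurable (valley u).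
Proof.
move=> up; apply: measurableI; first exact: measurable_shadowL up.
exact: measurable_shadowR up.
Qed.

(* With [b] the first return of [u] to the level [u x0], the interval runs from
   the last point before [b] where the slope is at most [- t] to the next point
   where it reaches [t], or to [b]. *)
Lemma valley_interval_neg u p x0 t : slope_sel q u p -> valley u x0 ->
  0 < t -> p x0 <= - t ->
  exists a b, [/\ -1 <= a, b <= 1, 2 * t <= q * (b - a) &
    forall z, a < z < b -> valley u z /\ `|p z| < t].
Proof.
move=> up [[x011 _] [_ [b0 [xb0 b01 ub0]]]] t0 px0.
pose Y := [set y | x0 < y <= 1 /\ u x0 <= u y].
have Yb0 : Y b0 by rewrite /Y /= xb0 b01 ltW.
have Y0 : Y !=set0 by exists b0.
have lbY : has_lbound Y by exists x0 => y [/andP[/ltW]].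
pose b := inf Y.
have bb0 : b <= b0 by exact: ge_inf.
(* After a slope [<= - t] at [x], climbing back to the level [u x] takes length at least
   [2 * t / q]: divide the supergradient inequality by [y - x]. *)
have drop x y : -1 < x < 1 -> x < y -> y <= 1 -> u x <= u y -> p x <= - t ->
    2 * t <= q * (y - x).
  move=> x11 xy y1 uxy px.
  have : u y <= u x + p x * (y - x) + q / 2 * (y - x) ^+ 2 by apply: up; lra.
  move=> H; have : t * (y - x) <= q / 2 * (y - x) * (y - x) by nra.
  by rewrite ler_pM2r ?subr_gt0//; lra.
have x0b' : 2 * t <= q * (b0 - x0) by apply: drop => //; exact: ltW.
have qp : 0 < q by rewrite lt_neqAle q0 andbT; apply/eqP => qq; rewrite -qq in x0b'; lra.
have Yt y : Y y -> 2 * t / q <= y - x0.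
  by move=> [/andP[y1 y2] y3]; rewrite ler_pdivrMr// [_ * q]mulrC; exact: drop.
have bt : x0 + 2 * t / q <= b.
  by apply: lb_le_inf => // y /Yt; lra.
have tq : 0 < 2 * t / q by rewrite divr_gt0// mulr_gt0.
have ltb z : x0 < z -> z < b -> u z < u x0.
  move=> x0z zb; have z1 : z <= 1 by lra.
  rewrite ltNge; apply/negP => uz; move: zb; rewrite ltNge => /negP; apply.
  by apply: ge_inf => //; split => //; rewrite x0z.
pose X := [set x | x0 <= x < b /\ p x <= - t].
have Xx0 : X x0 by split => //; lra.
have X0 : X !=set0 by exists x0.
have ubX : has_ubound X by exists b => x [/andP[_ /ltW]].
pose a := sup X.
have x0a : x0 <= a by exact: ub_le_sup.
(* Points of [X] are not above the level [u x0], so [drop] applies from each of them. The extrema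
   [a], [b] and the later [c] need not be attained, hence bounds are proved for members and then
   passed to the extremum. *)
have Xb x : X x -> x + 2 * t / q <= b.
  move=> [/andP[x1 x2] x3]; apply: lb_le_inf => // y Yy.
  have : 2 * t / q <= y - x; last by lra.
  rewrite ler_pdivrMr// [_ * q]mulrC; have /andP[y1 y2] := Yy.1.
  have by_ : b <= y by exact: ge_inf.
  apply: drop => //; [lra|lra|].
  apply: le_trans Yy.2; case: (ltgtP x0 x) x1 => // [x0x _|-> _ //].
  exact/ltW/ltb.
have ab : a + 2 * t / q <= b.
  suff : a <= b - 2 * t / q by lra.
  by apply: ge_sup => // x /Xb; lra.
have gea z : a < z -> z < b -> - t < p z.
  move=> az zb; have zx0 : x0 <= z < b by lra.
  rewrite ltNge; apply/negP => pz; move: az; rewrite ltNge => /negP; apply.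
  by apply: ub_le_sup.
pose T := [set z | a < z <= b /\ (z = b \/ t <= p z)].
have Tb : T b by split; [lra|left].
have T0 : T !=set0 by exists b.
have lbT : has_lbound T by exists a => y [/andP[/ltW]].
pose c := inf T.
have cb : c <= b by exact: ge_inf.
(* The interval ends either at the return to the level or where the slope reaches [t]; growing from
   [- t] to [t] at rate at most [q] also takes length [2 * t / q]. *)
have XT x z : X x -> T z -> x + 2 * t / q <= z.
  move=> Xx [/andP[az zb] [->|pz]]; first exact: Xb.
  case: (ltgtP z b) zb => // [zb _|-> _]; last exact: Xb.
  have xa : x <= a by exact: ub_le_sup.
  have [x1 x2] := Xx; have /andP[x11 x12] := x1.
  have := @sel_rate _ _ _ _ up x z.
  rewrite (_ : -1 < x); last lra.
  rewrite (_ : x <= z); last lra.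
  rewrite (_ : z < 1); last lra.
  move=> /(_ isT isT isT) H.
  have : 2 * t / q <= z - x by rewrite ler_pdivrMr// [_ * q]mulrC; lra.
  by lra.
have ac : a + 2 * t / q <= c.
  suff : a <= c - 2 * t / q by lra.
  apply: ge_sup => // x Xx.
  suff : x + 2 * t / q <= c by lra.
  by apply: lb_le_inf => // z Tz; exact: XT.
exists a, c; split; [lra|lra| |].
  have : 2 * t / q <= c - a by lra.
  by rewrite ler_pdivrMr// [_ * q]mulrC.
move=> z /andP[az zc]; have zb : z < b by lra.
have x0z : x0 < z by lra.
have uz := ltb z x0z zb.
have z11 : -1 < z < 1 by lra.
split; last first.
  have zab : a < z <= b by lra.
  rewrite ltr_norml gea//= ltNge; apply/negP => tz; move: zc; rewrite ltNge => /negP; apply.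
  by apply: ge_inf => //; split; [exact: zab|right].
by split; split => //; [exists x0|exists b0]; split => //; lra.
Qed.

Lemma valley_interval u p x0 t : slope_sel q u p -> valley u x0 ->
  0 < t -> t <= `|p x0| ->
  exists a b, [/\ -1 <= a, b <= 1, 2 * t <= q * (b - a) &
    forall z, a < z < b -> valley u z /\ `|p z| < t].
Proof.
move=> up Vx0 t0; rewrite ler_normr => /orP[tp|tp]; last first.
  by apply: valley_interval_neg => //; [exact: Vx0|lra].
have [|a [b [a1 b1 abt H]]] := valley_interval_neg (reflect_sel up) ((valley_reflect u x0).1 Vx0) t0.
  by rewrite opprK; lra.
exists (- b), (- a); split; [lra|lra| |].
  by move: abt; congr (_ <= _); ring.
move=> z zab; have [] := H (- z); first lra.
by rewrite opprK normrN -valley_reflect.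
Qed.

(** At a valley point of a concave function the supergradient would be positive because of the
    higher point to the right, and negative because of the one to the left. *)
Lemma valley_q0 u p : slope_sel q u p -> q = 0 -> valley u = set0.
Proof.
move=> up qq0; apply/seteqP; split => // x [[x11 [a [a1 a2 a3]]] [_ [b [b1 b2 b3]]]].
have : u a <= u x + p x * (a - x) + q / 2 * (a - x) ^+ 2 by apply: up; lra.
have : u b <= u x + p x * (b - x) + q / 2 * (b - x) ^+ 2 by apply: up; lra.
rewrite qq0 !mul0r !addr0 => H1 H2.
have : 0 < p x * (b - x) by lra.
have : 0 < p x * (a - x) by lra.
nra.
Qed.

End shadow.

(* The cost of the arc [|x| <= g] of the parabola [q / 2 * x^2]. *)
Definition parabola_cost {R : realType} (q g : R) : R :=
  if 0 < q then 2 / q * atan (q * g) else 2 * g.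

Section parabola_cost_theory.
Context {R : realType}.
Local Notation mu := (@lebesgue_measure R).
Implicit Types q g : R.

Lemma is_derive_parabola_cost q g : 0 <= q -> is_derive g 1 (parabola_cost q) (2 * drag (q * g)).
Proof.
move=> q0; rewrite /parabola_cost; have [qp|] := ltP 0 q; last first.
  move=> q0'; have -> : q = 0 by apply/eqP; rewrite eq_le q0' q0.
  rewrite mul0r /drag expr0n addr0 invr1.
  by apply: is_derive_eq; rewrite /GRing.scale/= mulr1.
have H : is_derive g 1 (fun x : R => q * x) q.
  by apply: is_derive_eq; rewrite /GRing.scale/= mulr1.
have := is_derive1_comp (is_derive1_atan (q * g)) H => H2.
have -> : (fun g : R => 2 / q * atan (q * g)) = (fun g : R => 2 / q *: (@atan R \o (fun x : R => q * x)) g) by [].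
apply: is_derive_eq; rewrite /GRing.scale/= /drag.
by field; rewrite !gt_eqF//= drag_den_gt0.
Qed.

Lemma parabola_cost0 q : parabola_cost q 0 = 0.
Proof. by rewrite /parabola_cost; case: ifPn; rewrite ?mulr0 ?atan0 ?mulr0. Qed.

Lemma parabola_costN q g : parabola_cost q (- g) = - parabola_cost q g.
Proof. by rewrite /parabola_cost; case: ifPn; rewrite ?mulrN ?atanN ?mulrN. Qed.

Lemma parabola_cost_mvt q g1 g2 : 0 <= q -> g1 < g2 ->
  exists2 c, g1 < c < g2 & parabola_cost q g2 - parabola_cost q g1 = 2 * drag (q * c) * (g2 - g1).
Proof.
move=> q0 g12.
have dF x : x \in `]g1, g2[ -> is_derive x 1 (parabola_cost q) (2 * drag (q * x)).
  by move=> _; exact: is_derive_parabola_cost.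
have cF : {within `[g1, g2], continuous (parabola_cost q)}.
  by apply: derivable_within_continuous => z _; have [] := is_derive_parabola_cost z q0.
by have [c] := MVT g12 dF cF; rewrite in_itv/= => c12 ->; exists c.
Qed.

Lemma continuous_dragM q : continuous (fun x : R => drag (q * x)).
Proof.
move=> t; apply: cvgV; first by rewrite gt_eqF// drag_den_gt0.
apply: cvgD; first exact: cvg_cst.
apply: (@continuous_comp _ _ _ (fun x => q * x) (fun x => x ^+ 2)).
  by apply: cvgM; [exact: cvg_cst|exact: cvg_id].
exact: exprn_continuous.
Qed.

Lemma integral_parabola_cost q g : 0 <= q -> 0 <= g ->
  \int[mu]_(x in `]-g, g[) drag (q * x) = parabola_cost q g.
Proof.
move=> q0; rewrite le_eqVlt => /predU1P[<-|g0].
  by rewrite oppr0 set_itvoo0 Rintegral_set0 parabola_cost0.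
have gg : - g < g by lra.
have mn (D : set R) : measurable D -> measurable_fun D (EFin \o (fun x : R => drag (q * x))).
  move=> mD; apply/measurable_EFinP; apply: measurable_funTS.
  by apply: continuous_measurable_fun; exact: continuous_dragM.
(* [parabola_cost q x / 2] is a primitive of [drag (q * x)], and it is odd. *)
have half : (parabola_cost q g / 2 - parabola_cost q (- g) / 2) = parabola_cost q g by rewrite parabola_costN; lra.
rewrite -half /Rintegral -[RHS]/(fine (parabola_cost q g / 2 - parabola_cost q (- g) / 2)%:E); congr fine.
rewrite integral_itv_obnd_cbnd; last exact: mn.
rewrite integral_itv_bndo_bndc; last exact: mn.
have dF (x : R) : is_derive x 1 (fun x : R => parabola_cost q x / 2) (drag (q * x)).
  have dx := is_derive_parabola_cost x q0.
  have -> : (fun x : R => parabola_cost q x / 2) = (fun x : R => 2^-1 *: parabola_cost q x).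
    by apply/funext => y; rewrite /GRing.scale/= mulrC.
  by apply: is_derive_eq; rewrite /GRing.scale/= mulKf.
have cF : continuous (fun x : R => parabola_cost q x / 2).
  by move=> x; apply: differentiable_continuous; apply/derivable1_diffP; have [] := dF x.
rewrite (@continuous_FTC2 _ _ (fun x : R => parabola_cost q x / 2)) ?EFinB//.
- by apply: continuous_subspaceT; exact: continuous_dragM.
- split.
  + by move=> x _; have [] := dF x.
  + by apply: cvg_at_right_filter; exact: cF.
  + by apply: cvg_at_left_filter; exact: cF.
- by move=> x _; rewrite derive1E; have [_ ->] := dF x.
Qed.

End parabola_cost_theory.

Section msr.
Context {R : realType}.
Local Notation mu := (@lebesgue_measure R).

(** [fine] sends an infinite measure to 0, hence the inclusions in ]-1, 1[ among the hypotheses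
    below. *)
Definition msr (A : set R) : R := fine (mu A).

Lemma msr_ge0 A : 0 <= msr A.
Proof. exact/fine_ge0. Qed.

Lemma msrE A : measurable A -> A `<=` oo11 -> mu A = (msr A)%:E.
Proof. by move=> mA A11; rewrite fineK// mu_sub_fin. Qed.

Lemma msr_le A B : measurable A -> measurable B -> B `<=` oo11 -> A `<=` B ->
  msr A <= msr B.
Proof.
move=> mA mB B11 AB; rewrite -lee_fin -!msrE//; last exact: subset_trans B11.
by apply: le_measure; rewrite ?inE.
Qed.

Lemma msr_itv (x y : bool) a b : a <= b -> msr [set` Interval (BSide x a) (BSide y b)] = b - a.
Proof.
move=> ab; rewrite /msr lebesgue_measure_itv /= lte_fin.
by case: ltgtP ab => // -> _; rewrite subrr.
Qed.

Lemma msr_oo11 : msr oo11 = 2.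
Proof. by rewrite /msr mu_oo11. Qed.

Lemma msr_setD A : measurable A -> A `<=` oo11 -> msr (oo11 `\` A) = 2 - msr A.
Proof.
move=> mA A11; have moo : measurable (oo11 : set R) by exact: measurable_itv.
have oofin : (mu oo11 < +oo)%E by rewrite mu_oo11 ltry.
rewrite -msr_oo11 /msr measureD// setIidr// fineB//; first by rewrite mu_sub_fin.
by rewrite mu_sub_fin.
Qed.

(** The set lies between its infimum and its supremum, so its measure is at most its diameter. *)
Lemma msr_diam (S : set R) (B C : R) : measurable S -> S `<=` oo11 -> 0 < B -> 0 <= C ->
  (forall x y, S x -> S y -> x < y -> B * (y - x) <= C) -> B * msr S <= C.
Proof.
move=> mS S11 B0 C0 BC.
have [->|/set0P[s Ss]] := eqVneq S set0; first by rewrite /msr measure0 mulr0.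
have ub : has_ubound S by exists 1 => x /S11 /andP[_ /ltW].
have lb : has_lbound S by exists (-1) => x /S11 /andP[/ltW].
have il : inf S <= s by exact: ge_inf.
have sl : s <= sup S by exact: ub_le_sup.
have SI : S `<=` `[inf S, sup S].
  by move=> x Sx; rewrite /= in_itv/= ge_inf// ub_le_sup.
have H x y : S x -> S y -> y <= x + C / B.
  move=> Sx Sy; case: (ltP x y) => [xy|yx]; last by rewrite (le_trans yx)// lerDl divr_ge0// ltW.
  have := BC _ _ Sx Sy xy; rewrite -ler_pdivlMl// => H.
  by rewrite -lerBlDl (le_trans H)// mulrC.
have H2 : sup S <= inf S + C / B.
  rewrite -lerBlDr; apply: lb_le_inf; first by exists s.
  move=> x Sx; rewrite lerBlDr; apply: ge_sup; first by exists s.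
  by move=> y Sy; exact: H.
rewrite mulrC -ler_pdivlMr//; apply: (@le_trans _ _ (sup S - inf S)); last by rewrite lerBlDl.
rewrite -(@msr_itv true false); last exact: le_trans sl.
rewrite /msr; apply: fine_le; first by rewrite mu_sub_fin.
  by rewrite lebesgue_measure_itv/=; case: ifPn.
by apply: le_measure; rewrite ?inE//; exact: measurable_itv.
Qed.

End msr.

(** * Lower bound for the cost of the valley *)

Section valley_cost.
Context {R : realType}.
Local Notation mu := (@lebesgue_measure R).
Variables (q : R) (u p : R -> R).
Hypotheses (q0 : 0 <= q) (up : slope_sel q u p).

(** The interval that comes with [x] for the level [t = |p x|] lies inside the valley. *)
Lemma valley_slope x : valley u x -> 2 * `|p x| <= q * msr (valley u).
Proof.
move=> Vx; have [->|px] := eqVneq (p x) 0.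
  by rewrite normr0 mulr0 mulr_ge0// msr_ge0.
have px0 : 0 < `|p x| by rewrite normr_gt0.
have [a [b [a1 b1 abt H]]] := valley_interval q0 up Vx px0 (lexx _).
have qp : 0 < q.
  rewrite lt_neqAle q0 andbT; apply/eqP => qq; move: abt; rewrite -qq mul0r; lra.
have ab : a <= b.
  rewrite leNgt; apply/negP => ba.
  have : q * (b - a) < 0 by rewrite pmulr_rlt0// subr_lt0.
  lra.
apply: le_trans abt _; rewrite ler_pM2l// -(@msr_itv _ false true)//.
apply: msr_le; [exact: measurable_itv|exact: measurable_valley q0 _ _ up|exact: valley_sub|].
by move=> z /= zab; have [] := H z zab.
Qed.

(** Both integrands are reduced by their common lower bound [drag (q * g)] before their tails are
    compared. Values of [g] below half the length of the valley serve in the equality case, where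
    they produce almost extremal slopes. *)
Lemma valley_cost (g : R) : 0 <= g -> 2 * g <= msr (valley u) ->
  (forall x, valley u x -> `|p x| <= q * g) ->
  parabola_cost q g + (msr (valley u) - 2 * g) * drag (q * g) <= \int[mu]_(x in valley u) drag (p x).
Proof.
move=> g0 gV pg; set V := valley u in gV pg *.
have mV : measurable V by exact: measurable_valley q0 _ _ up.
have V11 : V `<=` oo11 by exact: valley_sub.
set c := drag (q * g).
pose B : set R := `]-g, g[%classic.
have mB : measurable B by exact: measurable_itv.
have g1 : g <= 1.
  have := msr_le mV (measurable_itv _) (@subset_refl _ _) V11.
  by rewrite msr_oo11; lra.
have B11 : B `<=` oo11.
  by move=> x; rewrite /B /oo11 /= !in_itv/= => /andP[x1 x2]; lra.
have mnB : measurable_fun B (fun x => drag (q * x)).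
  by apply: measurable_funTS; apply: continuous_measurable_fun; exact: continuous_dragM.
have mnV : measurable_fun V (fun x => drag (p x)).
  apply: measurable_drag => //.
  exact: (measurable_funS (measurable_itv _) V11 (sel_measurable up)).
have cX x : V x -> 0 <= drag (p x) - c.
  by move=> /pg pgx; rewrite subr_ge0 drag_le [leRHS]ger0_norm// mulr_ge0.
have cY x : B x -> 0 <= drag (q * x) - c.
  rewrite /B /= in_itv/= => /andP[x1 x2]; rewrite subr_ge0 drag_le !normrM ler_wpM2l//.
  by rewrite (ger0_norm g0) ler_norml; lra.
have mX : measurable_fun V (fun x => drag (p x) - c) by exact: measurable_funB.
have mY : measurable_fun B (fun x => drag (q * x) - c) by exact: measurable_funB.
have tail r : 0 <= r -> (mu (B `&` [set x | r < drag (q * x) - c]%R) <=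
    mu (V `&` [set x | r < drag (p x) - c]%R))%E.
  move=> r0.
  have mBr : measurable (B `&` [set x | r < drag (q * x) - c]).
    have -> : B `&` [set x | r < drag (q * x) - c] =
        B `&` (fun x => drag (q * x) - c) @^-1` `]r, +oo[.
      by apply/seteqP; split => x /=; rewrite in_itv/= andbT.
    by apply: mY => //; exact: measurable_itv.
  have mVr : measurable (V `&` [set x | r < drag (p x) - c]).
    have -> : V `&` [set x | r < drag (p x) - c] =
        V `&` (fun x => drag (p x) - c) @^-1` `]r, +oo[.
      by apply/seteqP; split => x /=; rewrite in_itv/= andbT.
    by apply: mX => //; exact: measurable_itv.
  have Br11 : B `&` [set x | r < drag (q * x) - c] `<=` oo11 by move=> x [/B11].
  have Vr11 : V `&` [set x | r < drag (p x) - c] `<=` oo11 by move=> x [/V11].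
  rewrite !msrE// lee_fin.
  (* Either the level is exceeded on all of [V], which is at least as long as [B], or some point of
     [V] is steep enough to bring its own interval. *)
  have [allV|] := pselect (forall x, V x -> r < drag (p x) - c).
    rewrite [X in _ <= msr X](_ : _ = V); last first.
      by apply/seteqP; split => [x []//|x Vx]; split => //; exact: allV.
    apply: le_trans (le_trans _ gV).
      by apply: (msr_le mBr mB B11) => x [].
    by rewrite msr_itv; lra.
  move=> /existsNP[x0 /not_implyP[Vx0 /negP]]; rewrite -leNgt => rx0.
  have [cr1|cr1] := leP 1 (c + r).
    rewrite [X in msr X <= _](_ : _ = set0) ?/msr ?measure0 ?fine_ge0//.
    apply/seteqP; split => // x [_ /=]; rewrite ltrBrDl => H.
    by have := drag_le1 (q * x); rewrite leNgt (le_lt_trans cr1).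
  have cr0 : 0 < c + r by rewrite ltr_pwDl// drag_gt0.
  (* The slope with [drag t = c + r]; on the parabola the level is exceeded exactly for
     [|x| < t / q]. *)
  pose t := Num.sqrt ((c + r)^-1 - 1).
  have crt : 0 < (c + r)^-1 - 1 by rewrite subr_gt0 invf_gt1.
  have t0 : 0 < t by rewrite sqrtr_gt0.
  have nft : drag t = c + r by rewrite /drag sqr_sqrtr ?ltW// addrC subrK invrK.
  have tp : t <= `|p x0|.
    by rewrite -(ger0_norm (ltW t0)) -drag_le nft; lra.
  have [a [b [a1 b1 abt H]]] := valley_interval q0 up Vx0 t0 tp.
  have qp : 0 < q.
    rewrite lt_neqAle q0 andbT; apply/eqP => qq; move: abt; rewrite -qq mul0r; lra.
  have tq : 2 * t / q <= b - a by rewrite ler_pdivrMr// [_ * q]mulrC.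
  have tq0 : 0 < t / q by rewrite divr_gt0.
  apply: (@le_trans _ _ (2 * t / q)).
    have mI : measurable (`]- (t / q), t / q[%classic : set R) by exact: measurable_itv.
    have -> : 2 * t / q = msr `]- (t / q), t / q[ by rewrite msr_itv; lra.
    rewrite /msr; apply: fine_le; first by rewrite mu_sub_fin.
      by rewrite lebesgue_measure_itv/=; case: ifPn.
    apply: le_measure; rewrite ?inE// => x [_ /=]; rewrite ltrBrDl -nft drag_lt (ger0_norm (ltW t0)).
    by rewrite normrM (ger0_norm q0) in_itv/= -ltr_norml ltr_pdivlMr// mulrC.
  have ab : a <= b by rewrite -mulrA in tq; lra.
  apply: le_trans tq _; rewrite -(@msr_itv _ false true a b)//.
  apply: msr_le => //.
  move=> z /= zab; have [Vz pz] := H z zab; split => //.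
  by rewrite /= ltrBrDl -nft drag_lt (ger0_norm (ltW t0)).
have key := tail_le_integral mV mB mX mY cX cY tail.
have iX : mu.-integrable V (EFin \o (drag \o p)) by exact: (drag_sel_integrable up mV V11).
have iY : mu.-integrable B (EFin \o (fun x => drag (q * x))).
  by apply: (@bounded_integrable _ _ _ 1) => // x _; rewrite ger0_norm ?drag_le1// drag_ge0.
have icV : mu.-integrable V (EFin \o (fun=> c)).
  by apply: (@bounded_integrable _ _ _ `|c|).
have icB : mu.-integrable B (EFin \o (fun=> c)).
  by apply: (@bounded_integrable _ _ _ `|c|).
have : \int[mu]_(x in B) (drag (q * x) - c) <= \int[mu]_(x in V) (drag (p x) - c).
  apply: fine_le key; apply: integrable_fin_num => //.
    rewrite (_ : (fun x => _) = ((EFin \o (fun x => drag (q * x))) \- (EFin \o (fun=> c)))%E)//.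
    exact: integrableB.
  rewrite (_ : (fun x => _) = ((EFin \o (drag \o p)) \- (EFin \o (fun=> c)))%E)//.
  exact: integrableB.
rewrite !RintegralB// !Rintegral_cst// integral_parabola_cost// -!/(msr _) msr_itv; last lra.
have arith (A C G W I : R) : A - C * (G - - G) <= I - C * W -> A + (W - 2 * G) * C <= I.
  by clear; lra.
exact: arith.
Qed.

End valley_cost.

(** * Running maxima *)

Section halving_integral.
Context {R : realType}.
Local Notation mu := (@lebesgue_measure R).

(* On ]x, y] the integrand is at most [B x y] while [F] increases at rate at
   least [C x y] between any two points of [S]. It is used with [F] a running
   maximum of [u] and [S] the set where [u] attains it. *)
Lemma halving_integral (S : set R) (g F W : R -> R) (B C : R -> R -> R) (a b : R) :
  -1 < a -> a <= b -> b < 1 -> measurable S -> S `<=` oo11 -> measurable_fun oo11 g ->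
  (forall x y z, a <= x -> x <= y -> y <= b -> S z -> x < z <= y -> g z <= B x y) ->
  (forall x y, a <= x -> x <= y -> y <= b -> B x y - C x y <= W x - W y) ->
  (forall x y, a <= x -> x <= y -> y <= b -> 0 <= W x - W y) ->
  (forall x y, a <= x -> x <= y -> y <= b -> F x <= F y) ->
  (forall x y e e', a <= x -> x <= y -> y <= b -> S e -> S e' ->
    x < e -> e < e' -> e' <= y -> C x y * (e' - e) <= F y - F x) ->
  \int[mu]_(x in S `&` `]a, b]) Num.max (g x) 0 <= F b - F a.
Proof.
move=> a1 ab b1 mS' S11' mg gB BC W0 Fnd HC; rewrite -subr_le0.
pose Phi x y := \int[mu]_(x in S `&` `]x, y]) Num.max (g x) 0 - (F y - F x).
have mS (x y : R) : measurable (S `&` `]x, y]).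
  by apply: measurableI; [exact: mS'|exact: measurable_itv].
have S11 (x y : R) : S `&` `]x, y] `<=` oo11 by move=> z [/S11'].
have mmax (A : set R) : measurable A -> A `<=` oo11 -> measurable_fun A (fun x => Num.max (g x) 0).
  move=> mA A11; apply: measurable_maxr => //.
  exact: (measurable_funS (measurable_itv _) A11 mg).
have imax x y : a <= x -> x <= y -> y <= b ->
    mu.-integrable (S `&` `]x, y]) (EFin \o (fun x => Num.max (g x) 0)).
  move=> ax xy yb; apply: (@bounded_integrable _ _ _ `|B x y|) => //; first exact: mmax.
  move=> z [Sz]; rewrite /= in_itv/= => zxy.
  rewrite ger0_norm ?le_max ?lexx ?orbT// ge_max normr_ge0 andbT.
  by apply: le_trans (ler_norm _); exact: gB.
apply: (@halving_le0 _ Phi W a b ab) => [x y z ax xy yz zb|x y ax xy yb].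
  rewrite /Phi; have SU : S `&` `]x, z] = (S `&` `]x, y]) `|` (S `&` `]y, z]).
    by rewrite -setIUr -itv_bndbnd_setU.
  rewrite SU Rintegral_setU//.
  - by rewrite addrACA -opprD -[in leRHS](addrC (F z - _)) subrKA.
  - exact: mS.
  - exact: mS.
  - by rewrite -SU; apply: imax => //; exact: le_trans yz.
  - rewrite disj_set2E; apply/eqP/seteqP; split => // t [[_ +] [_ +]].
    by rewrite /= !in_itv/= => /andP[? ?] /andP[? ?]; lra.
have mono := Fnd x y ax xy yb.
have Wxy : 0 <= (y - x) * (W x - W y) by apply: mulr_ge0; [rewrite subr_ge0|exact: W0].
rewrite /Phi lerBlDr.
set T := S `&` _.
have pB z : T z -> g z <= B x y.
  by move=> [Sz /=]; rewrite in_itv/= => xzy; exact: gB.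
have [B0|B0] := leP (B x y) 0.
  rewrite (_ : Rintegral _ _ _ = 0); first by rewrite addr_ge0// subr_ge0.
  rewrite (@eq_Rintegral _ _ _ _ _ (fun=> 0)); last first.
    by move=> z /set_mem /pB pz; apply/max_idPr; exact: le_trans pz B0.
  by rewrite Rintegral_cst ?mul0r//; exact: mS.
apply: (@le_trans _ _ (B x y * msr T)).
  rewrite -Rintegral_cst; last exact: mS.
  apply: le_Rintegral; [exact: mS|exact: imax| |].
  - by apply: (@bounded_integrable _ _ _ `|B x y|) => //; [exact: mS|exact: S11].
  - by move=> z /pB pz; rewrite ge_max pz ltW.
apply: msr_diam => //; [exact: mS|exact: S11|by rewrite addr_ge0// subr_ge0|].
move=> e e' [re +] [re' +] ee'; rewrite /= !in_itv/= => /andP[xe ey] /andP[xe' ey'].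
have H1 := HC x y e e' ax xy yb re re' xe ee' ey'.
(* Replacing [C] by [B] costs at most [W x - W y] per unit length. *)
have H2 : (B x y - C x y) * (e' - e) <= (y - x) * (W x - W y).
  apply: (@le_trans _ _ ((W x - W y) * (e' - e))).
    by rewrite ler_wpM2r ?subr_ge0 ?BC// ltW.
  by rewrite mulrC ler_wpM2r ?W0// lerB// ltW.
by rewrite mulrBl lerBlDr in H2; rewrite (le_trans H2)// lerD2l.
Qed.

End halving_integral.

Section record.
Context {R : realType}.
Local Notation mu := (@lebesgue_measure R).

(** Record points, where [u] attains its running maximum from the left, resp. from the right. Their
    union is the complement of the valley ([ridgeE]). *)
Definition recL (u : R -> R) : set R := oo11 `\` shadowL u.
Definition recR (u : R -> R) : set R := oo11 `\` shadowR u.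

Definition runmax (u : R -> R) (x : R) := sup [set u z | z in [set z | -1 <= z <= x]].

Lemma recLP u x : recL u x -> forall y, -1 <= y -> y < x -> u y <= u x.
Proof.
move=> [x11 nS] y y1 yx; rewrite leNgt; apply/negP => uxy; apply: nS.
by split; [exact: x11|exists y].
Qed.

Lemma recRP u x : recR u x -> forall y, y <= 1 -> x < y -> u y <= u x.
Proof.
move=> [x11 nS] y y1 yx; rewrite leNgt; apply/negP => uxy; apply: nS.
by split; [exact: x11|exists y].
Qed.

Variables (q M : R) (u p : R -> R).
Hypotheses (q0 : 0 <= q) (up : slope_sel q u p).
Hypothesis uM : forall x, -1 <= x <= 1 -> 0 <= u x <= M.

Lemma measurable_recL : measurable (recL u).
Proof.
apply: measurableD; first exact: measurable_itv.
exact: measurable_shadowL q0 _ _ up.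
Qed.

Lemma measurable_recR : measurable (recR u).
Proof.
apply: measurableD; first exact: measurable_itv.
exact: measurable_shadowR q0 _ _ up.
Qed.

Lemma runmax_ub x z : x <= 1 -> -1 <= z -> z <= x -> u z <= runmax u x.
Proof.
move=> x1 z1 zx; apply: ub_le_sup; last by exists z => //=; rewrite z1.
exists M => _ [t /= /andP[t1 tx] <-].
have t11 : -1 <= t <= 1 by lra.
by have /andP[] := uM t11.
Qed.

Lemma runmax_le x c : -1 <= x -> (forall z, -1 <= z -> z <= x -> u z <= c) ->
  runmax u x <= c.
Proof.
move=> x1 H; apply: ge_sup; first by exists (u (-1)), (-1) => //=; rewrite lexx.
by move=> _ [z /= /andP[z1 zx] <-]; exact: H.
Qed.

Lemma recL_integral_le a b : -1 < a -> a <= b -> b < 1 ->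
  \int[mu]_(x in recL u `&` `]a, b]) Num.max (p x) 0 <= runmax u b - runmax u a.
Proof.
move=> a1 ab b1.
have rate x y : a <= x -> x <= y -> y <= b -> p y - p x <= q * (y - x) /\ 0 <= q * (y - x).
  move=> ax xy yb; split; first by apply: (sel_rate up) => //; lra.
  by rewrite mulr_ge0// subr_ge0.
(* As slopes grow at rate at most [q], on ]x, y] they lie between [p y - q * (y - x)] and
   [p x + q * (y - x)]; the difference of these bounds is the decrement of [p x - 2 * q * x]. *)
apply: (@halving_integral _ _ _ _ (fun x => p x - 2 * q * x)
  (fun x y => p x + q * (y - x)) (fun x y => p y - q * (y - x))) => //.
- exact: measurable_recL.
- by move=> z [].
- exact: sel_measurable up.
- move=> x y z ax xy yb _ /andP[xz zy].
  have [|||H1 _] := rate x z => //; [exact: ltW|lra|].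
  have [|||_ H2] := rate z y => //; [lra|].
  lra.
- by move=> x y ax xy yb /=; lra.
- by move=> x y ax xy yb /=; have [|||H1 H2] := rate x y => //; lra.
- move=> x y ax xy yb; apply: runmax_le; first lra.
  by move=> z z1 zx; apply: runmax_ub; lra.
- move=> x y e e' ax xy yb re re' xe ee' ey'.
  have ue : runmax u x <= u e.
    by apply: runmax_le; [lra|move=> z z1 zx; apply: (recLP re) => //; lra].
  have ue' : u e' <= runmax u y by apply: runmax_ub; lra.
  have H1 : u e <= u e' + p e' * (e - e') + q / 2 * (e - e') ^+ 2 by apply: up; lra.
  have [|||H2 _] := rate e' y => //; [lra|].
  have [|||_ H3] := rate x e => //; [lra|lra|].
  have [|||_ H4] := rate e e' => //; [lra|exact: ltW|lra|].
  have : (p y - q * (y - x)) * (e' - e) <= (p e' - q / 2 * (e' - e)) * (e' - e).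
    by apply: ler_wpM2r; [rewrite subr_ge0 ltW|lra].
  lra.
Qed.

Lemma recL_integral a b : -1 < a -> a <= b -> b < 1 ->
  \int[mu]_(x in recL u `&` `]a, b]) Num.max (p x) 0 <= M.
Proof.
move=> a1 ab b1; apply: le_trans (recL_integral_le a1 ab b1) _.
have : runmax u b <= M.
  apply: runmax_le; first lra.
  move=> z z1 zb; have z11 : -1 <= z <= 1 by lra.
  by have /andP[] := uM z11.
have : u (-1) <= runmax u a by apply: runmax_ub; lra.
have : 0 <= u (-1) <= M by apply: uM; rewrite lexx; lra.
by case/andP; lra.
Qed.

(** If [p x < 0], there is a jump at [x]: before [x] the slopes must let [u] climb to the record, so
    [p y - q * y] is at least [- (q * x)], while after [x] it is at most [p x - q * x]. *)
Lemma recL_slope x : recL u x -> ~ jumps q p x -> 0 <= p x.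
Proof.
move=> rx Jx; rewrite leNgt; apply/negP => px0; apply: Jx.
have x11 : -1 < x < 1 := rx.1.
split => //; exists (p x - q * x), (- (q * x)); split; first lra.
  move=> y y1 yx.
  have uyx : u y <= u x by apply: (recLP rx); lra.
  have H1 : u x <= u y + p y * (x - y) + q / 2 * (x - y) ^+ 2 by apply: up; lra.
  have H2 : - (q / 2 * (x - y)) * (x - y) <= p y * (x - y) by lra.
  rewrite ler_pM2r ?subr_gt0// in H2.
  have : 0 <= q * (x - y) by rewrite mulr_ge0// subr_ge0 ltW.
  lra.
move=> y xy y1; have /andP[x1 _] := x11.
by have := sel_rate up x1 (ltW xy) y1; lra.
Qed.

End record.

Section Rint.
Context {R : realType}.
Local Notation mu := (@lebesgue_measure R).

Lemma Rint_subset (A B : set R) (f : R -> R) : measurable A -> measurable B ->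
  A `<=` B -> mu.-integrable B (EFin \o f) -> (forall x, B x -> 0 <= f x) ->
  \int[mu]_(x in A) f x <= \int[mu]_(x in B) f x.
Proof.
move=> mA mB AB fi f0.
apply: fine_le.
- by apply: integrable_fin_num => //; exact: integrableS fi.
- exact: integrable_fin_num.
- by apply: ge0_subset_integral => //; exact: measurable_int fi.
Qed.

Lemma Rint_negligible (A N : set R) (f : R -> R) : measurable A -> measurable N ->
  mu N = 0%E -> mu.-integrable A (EFin \o f) ->
  \int[mu]_(x in A) f x = \int[mu]_(x in A `\` N) f x.
Proof. by move=> mA mN N0 fi; congr fine; exact: negligible_integral. Qed.

End Rint.

Section record_cost.
Context {R : realType}.
Local Notation mu := (@lebesgue_measure R).
Variables (q M : R) (u p : R -> R).
Hypotheses (q0 : 0 <= q) (up : slope_sel q u p).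
Hypothesis uM : forall x, -1 <= x <= 1 -> 0 <= u x <= M.

Let uM' : forall x, -1 <= x <= 1 -> 0 <= (u \o -%R) x <= M.
Proof. by move=> x x11; apply: uM; lra. Qed.

Lemma recR_integral a b : -1 < a -> a <= b -> b < 1 ->
  \int[mu]_(x in recR u `&` `]a, b]) Num.max (- p x) 0 <= M.
Proof.
move=> a1 ab b1.
have rate x y : a <= x -> x <= y -> y <= b -> p y - p x <= q * (y - x) /\ 0 <= q * (y - x).
  move=> ax xy yb; split; first by apply: (sel_rate up) => //; lra.
  by rewrite mulr_ge0// subr_ge0.
(* The running maximum from the right, by reflection; its negative is the nondecreasing function to
   be used. *)
pose rm x := runmax (u \o -%R) (- x).
have rm_ub x z : -1 <= x -> x <= z -> z <= 1 -> u z <= rm x.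
  move=> x1 xz z1; rewrite /rm -[z]opprK -[u _]/((u \o -%R) (- z)).
  by apply: (runmax_ub uM'); lra.
have rm_le x c : x <= 1 -> (forall z, x <= z -> z <= 1 -> u z <= c) -> rm x <= c.
  move=> x1 H; apply: runmax_le; first lra.
  by move=> z z1 zx /=; apply: H; lra.
apply: (@le_trans _ _ (- rm b - - rm a)); last first.
  have : rm a <= M.
    apply: rm_le; first lra.
    move=> z z1 zb; have z11 : -1 <= z <= 1 by lra.
    by have /andP[] := uM z11.
  have : u 1 <= rm b by apply: rm_ub; lra.
  have : 0 <= u 1 <= M by apply: uM; rewrite lexx; lra.
  lra.
apply: (@halving_integral _ _ _ (fun x => - rm x) (fun x => p x - 2 * q * x)
  (fun x y => - p y + q * (y - x)) (fun x y => - p x - q * (y - x))) => //.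
- exact: measurable_recR q0 up.
- by move=> z [].
- by apply: measurable_funN; exact: sel_measurable up.
- move=> x y z ax xy yb _ /andP[xz zy].
  have [|||H1 _] := rate z y => //; [lra|].
  have [|||_ H2] := rate x z => //; [exact: ltW|lra|].
  lra.
- by move=> x y ax xy yb /=; lra.
- by move=> x y ax xy yb /=; have [|||H1 H2] := rate x y => //; lra.
- move=> x y ax xy yb; rewrite lerN2; apply: rm_le; first lra.
  by move=> z z1 zx; apply: rm_ub; lra.
- move=> x y e e' ax xy yb re re' xe ee' ey'.
  have ue : rm y <= u e'.
    apply: rm_le; [lra|move=> z z1 zx].
    case: (ltgtP e' z) => [e'z|ze'|-> //]; [by apply: (recRP re'); lra|lra].
  have ue' : u e <= rm x by apply: rm_ub; lra.
  have H1 : u e' <= u e + p e * (e' - e) + q / 2 * (e' - e) ^+ 2 by apply: up; lra.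
  have [|||H2 _] := rate x e => //; [exact: ltW|lra|].
  have [|||_ H3] := rate e' y => //; [lra|].
  have [|||_ H4] := rate e e' => //; [lra|exact: ltW|lra|].
  have : (- p x - q * (y - x)) * (e' - e) <= (- p e - q / 2 * (e' - e)) * (e' - e).
    by apply: ler_wpM2r; [rewrite subr_ge0 ltW|lra].
  lra.
Qed.

Lemma recR_slope x : recR u x -> ~ jumps q p x -> p x <= 0.
Proof.
move=> rx Jx; rewrite leNgt; apply/negP => px0; apply: Jx.
have x11 : -1 < x < 1 := rx.1.
split => //; exists (- (q * x)), (p x - q * x); split; first lra.
  move=> y y1 yx; have /andP[_ x1] := x11.
  by have := sel_rate up y1 (ltW yx) x1; lra.
move=> y xy y1.
have uyx : u y <= u x by apply: (recRP rx); lra.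
have H1 : u x <= u y + p y * (x - y) + q / 2 * (x - y) ^+ 2 by apply: up; lra.
have H2 : p y * (y - x) <= q / 2 * (y - x) * (y - x) by lra.
rewrite ler_pM2r ?subr_gt0// in H2.
have : 0 <= q * (y - x) by rewrite mulr_ge0// subr_ge0 ltW.
lra.
Qed.

(** Slopes may be unbounded near -1 and 1 but are bounded here. The bound on the integral of [|p|]
    will not depend on [e]. *)
Definition inner_itv (e : R) : set R := `]-1 + e, 1 - e]%classic.

Lemma inner_itv_sub e : 0 < e -> inner_itv e `<=` oo11.
Proof. by move=> e0 x; rewrite /inner_itv /oo11 /= !in_itv/= => /andP[? ?]; lra. Qed.

Lemma sel_bounded e : 0 < e < 1 -> exists2 C, 0 <= C & forall x, inner_itv e x -> `|p x| <= C.
Proof.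
move=> /andP[e0 e1]; exists (`|p (-1 + e)| + `|p (1 - e)| + q * 2).
  by rewrite !addr_ge0// mulr_ge0.
move=> x; rewrite /inner_itv /= in_itv/= => /andP[x1 x2].
have H1 := ler_norm (p (-1 + e)); have H2 := ler_norm (- p (1 - e)).
rewrite normrN in H2.
have A1 : p x - p (-1 + e) <= q * (x - (-1 + e)) by apply: (sel_rate up); lra.
have A2 : p (1 - e) - p x <= q * (1 - e - x) by apply: (sel_rate up); lra.
have B1 : q * (x - (-1 + e)) <= q * 2 by rewrite ler_wpM2l//; lra.
have B2 : q * (1 - e - x) <= q * 2 by rewrite ler_wpM2l//; lra.
have n1 := normr_ge0 (p (-1 + e)); have n2 := normr_ge0 (p (1 - e)).
by rewrite ler_norml; apply/andP; split; lra.
Qed.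

Definition ridge : set R := oo11 `\` valley u.

Lemma measurable_ridge : measurable ridge.
Proof.
apply: measurableD; first exact: measurable_itv.
exact: measurable_valley q0 _ _ up.
Qed.

Lemma ridge_sub : ridge `<=` oo11. Proof. by move=> x []. Qed.

Lemma ridgeE : ridge = recL u `|` recR u.
Proof. by rewrite /ridge /recL /recR /valley setDIr. Qed.

Lemma measurable_jumps : measurable (jumps q p).
Proof.
apply: countable_measurable; first exact: measurable_set1.
exact: jumps_countable.
Qed.

Lemma mu_jumps : mu (jumps q p) = 0%E.
Proof. exact/countable_lebesgue_measure0/jumps_countable. Qed.

(** Off the jumps the slope is nonnegative at left records and nonpositive at right records, so
    [|p|] is dominated by [g1 + g2]. Each running maximum rises by at most [M]. *)
Lemma ridge_variation e : 0 < e < 1 ->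
  \int[mu]_(x in ridge `&` inner_itv e) `|p x| <= 2 * M.
Proof.
move=> e01; have [C C0 pC] := sel_bounded e01; have /andP[e0 e1] := e01.
set A := ridge `&` _.
have mA : measurable A by apply: measurableI; [exact: measurable_ridge|exact: measurable_itv].
have A11 : A `<=` oo11 by move=> x [/ridge_sub].
have mp : measurable_fun A p := measurable_funS (measurable_itv _) A11 (sel_measurable up).
pose g1 := (fun x => Num.max (p x) 0) \_ (recL u).
pose g2 := (fun x => Num.max (- p x) 0) \_ (recR u).
have mN := measurable_jumps.
have mrL : measurable (recL u) := measurable_recL q0 up.
have mrR : measurable (recR u) := measurable_recR q0 up.
have mpI B : measurable_fun (A `&` B) p by apply: (measurable_funS mA _ mp) => x [].
have mg1 : measurable_fun A g1.
  apply/(@measurable_restrict _ _ _ _ (recL u) A _ mrL mA).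
  exact: measurable_maxr.
have mg2 : measurable_fun A g2.
  apply/(@measurable_restrict _ _ _ _ (recR u) A _ mrR mA).
  by apply: measurable_maxr => //; exact: measurable_funN.
have ip : mu.-integrable A (EFin \o (fun x => `|p x|)).
  apply: (@bounded_integrable _ _ _ C) => //; first exact: measurableT_comp.
  by move=> x [_ /pC]; rewrite normr_id.
have bnd (t : R) : 0 <= Num.max t 0 <= `|t|.
  by rewrite le_max lexx orbT/= ge_max ler_norm/=.
have ig1 : mu.-integrable A (EFin \o g1).
  apply: (@bounded_integrable _ _ _ C) => // x [_ /pC pxC]; rewrite /g1 patchE.
  case: ifPn => _; last by rewrite normr0.
  by have /andP[h1 h2] := bnd (p x); rewrite ger0_norm// (le_trans h2).
have ig2 : mu.-integrable A (EFin \o g2).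
  apply: (@bounded_integrable _ _ _ C) => // x [_ /pC pxC]; rewrite /g2 patchE.
  case: ifPn => _; last by rewrite normr0.
  by have := bnd (- p x); rewrite normrN => /andP[h1 h2]; rewrite ger0_norm// (le_trans h2).
have mAN : measurable (A `\` jumps q p) by exact: measurableD.
have sub : A `\` jumps q p `<=` A by move=> x [].
rewrite (Rint_negligible mA mN mu_jumps ip).
apply: (@le_trans _ _ (\int[mu]_(x in A `\` jumps q p) (g1 x + g2 x))).
  apply: le_Rintegral => //.
  - exact: integrableS ip.
  - rewrite (_ : _ \o _ = ((EFin \o g1) \+ (EFin \o g2))%E)//.
    by apply: integrableD => //; [exact: integrableS ig1|exact: integrableS ig2].
  move=> x [[+ _] Jx]; rewrite ridgeE => rx.
  have g10 : 0 <= g1 x by rewrite /g1 patchE; case: ifPn => // _; case/andP: (bnd (p x)).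
  have g20 : 0 <= g2 x by rewrite /g2 patchE; case: ifPn => // _; case/andP: (bnd (- p x)).
  case: rx => rx.
    have px := recL_slope q0 up rx Jx.
    apply: (@le_trans _ _ (g1 x)); last by rewrite lerDl.
    by rewrite ger0_norm// /g1 patchE mem_set// le_max lexx.
  have px := recR_slope rx Jx.
  apply: (@le_trans _ _ (g2 x)); last by rewrite lerDr.
  by rewrite ler0_norm// /g2 patchE mem_set// le_max lexx.
rewrite RintegralD//; [|exact: integrableS ig1|exact: integrableS ig2].
rewrite -(Rint_negligible mA mN mu_jumps ig1) -(Rint_negligible mA mN mu_jumps ig2).
rewrite -!Rintegral_mkcondr.
have -> : A `&` recL u = recL u `&` inner_itv e.
  by apply/seteqP; split => [x [[_ ?] ?]//|x [? ?]]; split => //; split => //; rewrite ridgeE; left.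
have -> : A `&` recR u = recR u `&` inner_itv e.
  by apply/seteqP; split => [x [[_ ?] ?]//|x [? ?]]; split => //; split => //; rewrite ridgeE; right.
have E1 : -1 < -1 + e by lra.
have E2 : 1 - e < 1 by lra.
have [E3|E3] := leP (-1 + e) (1 - e).
  rewrite mulr_natl mulr2n; apply: lerD.
    exact: (recL_integral q0 up uM).
  exact: recR_integral.
have -> : inner_itv e = set0.
  by apply/seteqP; split => // x; rewrite /inner_itv /= in_itv/= => /andP[? ?]; lra.
rewrite !setI0 !Rintegral_set0 addr0 mulr_ge0//.
have : 0 <= u 1 <= M by apply: uM; rewrite lexx; lra.
by case/andP => h1 h2; exact: le_trans h1 h2.
Qed.

End record_cost.

(** * Lower bound for the cost off the valley *)

Lemma msr_inner_compl {R : realType} (e : R) : 0 < e < 1 ->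
  msr (oo11 `\` inner_itv e) = 2 * e.
Proof.
move=> /andP[e0 e1]; rewrite msr_setD; last exact: inner_itv_sub.
  by rewrite /inner_itv msr_itv; lra.
exact: measurable_itv.
Qed.

(** Bookkeeping for [ridge_cost]: [nA], [nE] are the costs of the inner part and of the whole ridge,
    [mA], [mE] their lengths times [I], [v] and [w] the variation and its bound times [k], [d] the
    loss near the ends. *)
Lemma le_combine {R : realType} (phi nA nE mA mE v w d : R) :
  phi <= nA - (mA - v) -> nA <= nE -> v <= w -> mE <= mA + d ->
  phi + mE - w <= nE + d.
Proof. lra. Qed.

Section ridge_cost.
Context {R : realType}.
Local Notation mu := (@lebesgue_measure R).
Variables (q M : R) (u p : R -> R).
Hypotheses (q0 : 0 <= q) (up : slope_sel q u p).
Hypothesis uM : forall x, -1 <= x <= 1 -> 0 <= u x <= M.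

Lemma cost_split : \int[mu]_(x in oo11) drag (p x) =
  \int[mu]_(x in valley u) drag (p x) + \int[mu]_(x in ridge u) drag (p x).
Proof.
have mV : measurable (valley u) := measurable_valley q0 up.
have mE : measurable (ridge u) := measurable_ridge q0 up.
have moo : measurable (oo11 : set R) by exact: measurable_itv.
have U : oo11 = valley u `|` ridge u by rewrite /ridge setDUK//; exact: valley_sub.
rewrite [in LHS]U Rintegral_setU//.
  by rewrite -U; exact: (drag_sel_integrable up).
by rewrite disj_set2E /ridge setDIK.
Qed.

Lemma msr_ridge : msr (ridge u) = 2 - msr (valley u).
Proof. by apply: msr_setD; [exact: (measurable_valley q0 up)|exact: valley_sub]. Qed.

(** Integrate the line over inner intervals, where the variation is at most [2 * M], and let them
    exhaust ]-1, 1[. The excess over the line is kept on one fixed inner interval: it must vanish in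
    the equality case. *)
Lemma ridge_cost (I k e0 : R) : 0 <= I -> 0 <= k -> 0 < e0 < 1 ->
  (forall s, 0 <= s -> I - k * s <= drag s) ->
  \int[mu]_(x in ridge u `&` inner_itv e0) (drag (p x) - (I - k * `|p x|))
    + I * msr (ridge u) - k * (2 * M) <= \int[mu]_(x in ridge u) drag (p x).
Proof.
move=> I0 k0 /andP[e00 e01] line.
have mE : measurable (ridge u) := measurable_ridge q0 up.
have E11 := @ridge_sub _ u.
pose phi x := drag (p x) - (I - k * `|p x|).
have phi0 x : 0 <= phi x by rewrite subr_ge0 -[drag _]drag_norm line.
have main e : 0 < e -> e <= e0 ->
    \int[mu]_(x in ridge u `&` inner_itv e0) phi x + I * msr (ridge u) - k * (2 * M)
    <= \int[mu]_(x in ridge u) drag (p x) + e * (2 * I).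
  move=> ep ee0; have e1 : 0 < e < 1 by lra.
  have [C C0 pC] := sel_bounded q0 up e1.
  set A := ridge u `&` inner_itv e.
  have mJ e' : measurable (inner_itv e' : set R) by exact: measurable_itv.
  have mA : measurable A by exact: measurableI.
  have A11 : A `<=` oo11 by move=> x [/E11].
  have mp : measurable_fun A p := measurable_funS (measurable_itv _) A11 (sel_measurable up).
  have infp : mu.-integrable A (EFin \o (drag \o p)) by exact: (drag_sel_integrable up).
  have ip : mu.-integrable A (EFin \o (fun x => `|p x|)).
    apply: (@bounded_integrable _ _ _ C) => //; first exact: measurableT_comp.
    by move=> x [_ /pC]; rewrite normr_id.
  have iI : mu.-integrable A (EFin \o (fun=> I)) by apply: (@bounded_integrable _ _ _ `|I|).
  have ikp : mu.-integrable A (EFin \o (fun x => k * `|p x|)).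
    rewrite (_ : _ \o _ = (fun x => k%:E * (`|p x|)%:E)%E)//.
    exact: integrableZl.
  have iIkp : mu.-integrable A (EFin \o (fun x => I - k * `|p x|)).
    rewrite (_ : _ \o _ = ((EFin \o (fun=> I)) \- (EFin \o (fun x => k * `|p x|)%R))%E)//.
    exact: integrableB.
  have iphi : mu.-integrable A (EFin \o phi).
    rewrite (_ : _ \o _ = ((EFin \o (drag \o p)) \- (EFin \o (fun x => I - k * `|p x|)%R))%E)//.
    exact: integrableB.
  have H1 : \int[mu]_(x in ridge u `&` inner_itv e0) phi x <= \int[mu]_(x in A) phi x.
    apply: Rint_subset => //; first exact: measurableI.
    move=> x [? +]; split => //; move: b; rewrite /inner_itv /= !in_itv/= => /andP[? ?]; lra.
  have H2 : \int[mu]_(x in A) phi x = \int[mu]_(x in A) drag (p x) -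
      (I * msr A - k * \int[mu]_(x in A) `|p x|).
    by rewrite /phi RintegralB// RintegralB// Rintegral_cst// RintegralZl.
  have H3 : \int[mu]_(x in A) drag (p x) <= \int[mu]_(x in ridge u) drag (p x).
    apply: Rint_subset => //; [by move=> x []|exact: (drag_sel_integrable up)|].
    by move=> x _; exact: drag_ge0.
  have H4 : k * \int[mu]_(x in A) `|p x| <= k * (2 * M).
    by rewrite ler_wpM2l//; exact: (ridge_variation q0 up uM).
  have H5 : I * msr (ridge u) <= I * msr A + e * (2 * I).
    rewrite (_ : e * (2 * I) = I * (2 * e)); last by rewrite mulrC -mulrA mulrCA.
    rewrite -mulrDr ler_wpM2l//.
    have JJ : inner_itv e `<=` oo11 by apply: inner_itv_sub.
    rewrite -msr_inner_compl//.
    have mC : measurable (oo11 `\` inner_itv e : set R).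
      by apply: measurableD => //; exact: measurable_itv.
    have F1 : mu A \is a fin_num by exact: mu_sub_fin.
    have F2 : mu (oo11 `\` inner_itv e) \is a fin_num by apply: mu_sub_fin => // x [].
    have F3 : mu (ridge u) \is a fin_num by exact: mu_sub_fin.
    rewrite /msr -fineD//; apply: fine_le => //; first by rewrite fin_numD F1 F2.
    apply: le_trans (measureU2 _ _ _) => //.
    apply: le_measure; rewrite ?inE//.
      exact: measurableU.
    move=> x Ex; have [Jx|Jx] := pselect (inner_itv e x); [left|right]; split => //.
    exact: E11.
  by rewrite H2 in H1; exact: (le_combine H1 H3 H4 H5).
apply/ler_addgt0Pr => e ep.
pose e' := Num.min e0 (e / (2 * I + 1)).
have I1 : 0 < 2 * I + 1 by rewrite ltr_wpDl// mulr_ge0.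
have e'0 : 0 < e' by rewrite lt_min e00 divr_gt0.
have e'e0 : e' <= e0 by rewrite ge_min lexx.
apply: le_trans (main e' e'0 e'e0) _; rewrite lerD2l.
have : e' <= e / (2 * I + 1) by rewrite ge_min lexx orbT.
rewrite ler_pdivlMr//; apply: le_trans.
by rewrite ler_wpM2l ?lerDl// ltW.
Qed.

End ridge_cost.

(** * The function R *)

Section Rfun_theory.
Context {R : realType}.
Variables (M q : R).
Hypotheses (M0 : 0 < M) (q0 : 0 <= q) (q1 : q <= 1).

Lemma RfunE g : Rfun M q g = parabola_cost q g + 2 * (1 - g) ^+ 3 / (M ^+ 2 + (1 - g) ^+ 2).
Proof. by []. Qed.

Lemma Rfun_drag g : g < 1 -> Rfun M q g = parabola_cost q g + 2 * (1 - g) * drag (M / (1 - g)).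
Proof.
move=> g1; rewrite RfunE /drag; congr (_ + _).
have g0 : 1 - g != 0 by rewrite gt_eqF// subr_gt0.
have d0 : (1 - g) ^+ 2 + M ^+ 2 != 0 by rewrite gt_eqF// ltr_wpDl ?exprn_gt0// sqr_ge0.
by field; rewrite d0 g0.
Qed.

Lemma Rfun1 : Rfun M q 1 = parabola_cost q 1.
Proof. by rewrite RfunE subrr expr0n/= mulr0 mul0r addr0. Qed.

(** The numerator of the derivative of R, whose sign it shares. *)
Definition Dfun g := (M ^+ 2 + (1 - g) ^+ 2) ^+ 2
  - (1 - g) ^+ 2 * (3 * M ^+ 2 + (1 - g) ^+ 2) * (1 + (q * g) ^+ 2).

Definition dRfun g := 2 * Dfun g / ((1 + (q * g) ^+ 2) * (M ^+ 2 + (1 - g) ^+ 2) ^+ 2).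

Lemma is_derive_Rfun (g : R) : is_derive g 1 (Rfun M q) (dRfun g).
Proof.
have d0 (x : R) : M ^+ 2 + (1 - x) ^+ 2 != 0 by rewrite gt_eqF// ltr_pwDl ?exprn_gt0// sqr_ge0.
have dp := is_derive_parabola_cost g q0.
pose num (x : R) : R := 2 * (1 - x) ^+ 3.
pose den (x : R) : R := M ^+ 2 + (1 - x) ^+ 2.
have dnum : is_derive g 1 num (- (6 * (1 - g) ^+ 2)).
  by apply: is_derive_eq; rewrite /GRing.scale/=; ring.
have dden : is_derive g 1 den (- (2 * (1 - g))).
  by apply: is_derive_eq; rewrite /GRing.scale/=; ring.
have dg0 : den g != 0 := d0 g.
have dinv := is_deriveV dg0 dden.
have dprod := is_deriveM dnum dinv.
have := is_deriveD dp dprod.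
have -> : parabola_cost q + num * (fun x => (den x)^-1) = Rfun M q by [].
move=> H; apply: (is_derive_eq H).
rewrite /dRfun /Dfun /GRing.scale/= /drag /num /den.
have := d0 g; have := gt_eqF (drag_den_gt0 (q * g)) => /negbT h1 h2.
by field; rewrite h2 h1.
Qed.

Lemma dRfun_gt0 g : (0 < dRfun g) = (0 < Dfun g).
Proof.
rewrite /dRfun pmulr_lgt0; first by rewrite pmulr_rgt0.
by rewrite invr_gt0 mulr_gt0 ?drag_den_gt0// exprn_gt0// ltr_pwDl ?exprn_gt0// sqr_ge0.
Qed.

Lemma dRfun_lt0 g : (dRfun g < 0) = (Dfun g < 0).
Proof.
rewrite /dRfun pmulr_llt0; first by rewrite pmulr_rlt0.
by rewrite invr_gt0 mulr_gt0 ?drag_den_gt0// exprn_gt0// ltr_pwDl ?exprn_gt0// sqr_ge0.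
Qed.

Lemma Rfun_mvt a b : a < b ->
  exists2 c, a < c < b & Rfun M q b - Rfun M q a = dRfun c * (b - a).
Proof.
move=> ab.
have dF x : x \in `]a, b[ -> is_derive x 1 (Rfun M q) (dRfun x).
  by move=> _; exact: is_derive_Rfun.
have cF : {within `[a, b], continuous (Rfun M q)}.
  by apply: derivable_within_continuous => z _; have [] := is_derive_Rfun z.
by have [c] := MVT ab dF cF; rewrite in_itv/= => c12 ->; exists c.
Qed.

(** In terms of [x = 1 - b] and [y = 1 - a] the difference is [y - x] times [M^2 * s + q^2 * T].
    Here [T >= - 5 / 8 * M^2 * s], using [y <= M], so the first term prevails as [q <= 1]. *)
Lemma Dfun_lt a b : 0 <= a -> 1 - M <= a -> a < b -> b <= 1 -> Dfun a < Dfun b.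
Proof.
move=> a0 aM ab b1.
pose x := 1 - b; pose y := 1 - a; pose s := x + y.
have x0 : 0 <= x by rewrite /x; lra.
have xy : x < y by rewrite /x /y; lra.
have y1 : y <= 1 by rewrite /y; lra.
have yM : y <= M by rewrite /y; lra.
have ym : y ^+ 2 <= M ^+ 2 by rewrite ler_pXn2r// nnegrE ltW//; lra.
have s0 : 0 < s by rewrite /s; lra.
have s2 : s <= 2 by rewrite /s; lra.
pose A := (y - y ^+ 2) + (x - x ^+ 2).
pose B := y * (y - y ^+ 2) + x * (x - x ^+ 2).
have A0 : 0 <= A by rewrite /A; nra.
have A1 : A <= s * (1 - s / 2) by rewrite /A /s; nra.
have B0 : 0 <= B.
  by rewrite /B; apply: addr_ge0; apply: mulr_ge0 => //; [lra|nra|nra].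
have B1 : B <= y ^+ 2 * (2 - s).
  have : x * (x - x ^+ 2) <= y ^+ 2 * (1 - x).
    have -> : x * (x - x ^+ 2) = x ^+ 2 * (1 - x) by ring.
    by rewrite ler_wpM2r ?subr_ge0//; [lra|rewrite ler_pXn2r// ?nnegrE; lra].
  by rewrite /B /s; lra.
(* The maximum is at [s = 3 / 2]. This yields the 3/8 in [F1] and the 1/4 in [F2], whose sum is
   below 1. *)
have s14 : (s - 1) * (2 - s) <= 1 / 4.
  by have := sqr_ge0 (s - 3 / 2); nra.
have F1 : - (3 / 8 * s) <= 3 * (1 - s) * A.
  have [s1|s1] := leP s 1.
    by apply: (@le_trans _ _ 0); [lra|rewrite !mulr_ge0//; lra].
  have : (s - 1) * A <= (s - 1) * (s * (1 - s / 2)) by rewrite ler_wpM2l//; lra.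
  have : (s - 1) * (2 - s) * s <= 1 / 4 * s by rewrite ler_wpM2r// ltW.
  lra.
have F2 : - (1 / 4 * s * y ^+ 2) <= (s - (x ^+ 2 + x * y + y ^+ 2)) * B.
  have [s1|s1] := leP (x ^+ 2 + x * y + y ^+ 2) s.
    apply: (@le_trans _ _ 0); last by rewrite mulr_ge0// subr_ge0.
    by rewrite oppr_le0 mulr_ge0// ?sqr_ge0// mulr_ge0// ltW.
  have K : x ^+ 2 + x * y + y ^+ 2 - s <= s * (s - 1).
    have : 0 <= x * y by rewrite mulr_ge0//; lra.
    by rewrite /s; lra.
  have K0 : 0 <= x ^+ 2 + x * y + y ^+ 2 - s by lra.
  have H1 : (x ^+ 2 + x * y + y ^+ 2 - s) * B <= s * (s - 1) * (y ^+ 2 * (2 - s)).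
    exact: ler_pM.
  have : (s - 1) * (2 - s) * (s * y ^+ 2) <= 1 / 4 * (s * y ^+ 2).
    by rewrite ler_wpM2r// mulr_ge0 ?sqr_ge0// ltW.
  lra.
have Q0 : 0 <= q ^+ 2 by exact: sqr_ge0.
have Q1 : q ^+ 2 <= 1 by rewrite expr_le1.
have m0 : 0 < M ^+ 2 by rewrite exprn_gt0.
rewrite -subr_gt0.
have -> : Dfun b - Dfun a = (y - x) * (M ^+ 2 * s + q ^+ 2 *
    (M ^+ 2 * (3 * (1 - s) * A) + (s - (x ^+ 2 + x * y + y ^+ 2)) * B)).
  by rewrite /Dfun /A /B /s /x /y; ring.
apply: mulr_gt0; first by rewrite subr_gt0.
have G1 : M ^+ 2 * (- (3 / 8 * s)) <= M ^+ 2 * (3 * (1 - s) * A) by rewrite ler_wpM2l// ltW.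
have G2 : s * y ^+ 2 <= s * M ^+ 2 by rewrite ler_wpM2l// ltW.
set T := M ^+ 2 * (3 * (1 - s) * A) + _.
have G3 : - (5 / 8 * (M ^+ 2 * s)) <= T by rewrite /T; lra.
have ms : 0 < M ^+ 2 * s by rewrite mulr_gt0.
have G4 : q ^+ 2 * (- (5 / 8 * (M ^+ 2 * s))) <= q ^+ 2 * T by rewrite ler_wpM2l.
have G5 : q ^+ 2 * (5 / 8 * (M ^+ 2 * s)) <= 1 * (5 / 8 * (M ^+ 2 * s)).
  by rewrite ler_wpM2r// mulr_ge0// ltW.
lra.
Qed.

(** R increases near 1, so its minimizer is not 1. For [1 - g <= M / 3] the subtracted term is at
    most [56 / 81 * M^4]. *)
Lemma Dfun_gt0_near1 g : 1 - M / 3 <= g -> 0 <= g -> g <= 1 -> 0 < Dfun g.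
Proof.
move=> gM g0 g1; pose s := 1 - g.
have s0 : 0 <= s by rewrite /s; lra.
have sM : s <= M / 3 by rewrite /s; lra.
have s2 : s ^+ 2 <= M ^+ 2 / 9.
  have -> : M ^+ 2 / 9 = (M / 3) ^+ 2 by field.
  by rewrite ler_pXn2r// nnegrE; lra.
have Q1 : (q * g) ^+ 2 <= 1 by rewrite expr_le1// ?mulr_ge0// mulr_ile1.
have m0 : 0 < M ^+ 2 by rewrite exprn_gt0.
have s20 := sqr_ge0 s.
have H : s ^+ 2 * (3 * M ^+ 2 + s ^+ 2) * (1 + (q * g) ^+ 2) <=
   s ^+ 2 * (3 * M ^+ 2 + s ^+ 2) * 2.
  by rewrite ler_wpM2l//; [rewrite mulr_ge0//; lra|lra].
rewrite /Dfun -/s subr_gt0; apply: le_lt_trans H _.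
have H1 : s ^+ 2 * s ^+ 2 <= M ^+ 2 / 9 * (M ^+ 2 / 9) by apply: ler_pM.
have H2 : M ^+ 2 * s ^+ 2 <= M ^+ 2 * (M ^+ 2 / 9) by rewrite ler_wpM2l// ltW.
have mm : 0 < M ^+ 2 * M ^+ 2 by rewrite mulr_gt0.
lra.
Qed.

(* [M / (1 - g) >= 1] exactly for the half-widths [g] from this value on. *)
Definition min_half_width := Num.max 0 (1 - M).

Lemma min_half_width_ge0 : 0 <= min_half_width. Proof. by rewrite /min_half_width le_max lexx. Qed.

Lemma min_half_width_geM : 1 - M <= min_half_width. Proof. by rewrite /min_half_width le_max lexx orbT. Qed.

Lemma min_half_width_lt1 : min_half_width < 1. Proof. by have := M0; rewrite /min_half_width gt_max => ?; apply/andP; split; lra. Qed.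

Lemma Rfun_strict_min : exists g, [/\ min_half_width <= g, g < 1, 1 <= M -> g = 0
  & forall x, min_half_width <= x -> x <= 1 -> x != g -> Rfun M q g < Rfun M q x].
Proof.
have g0 := min_half_width_ge0; have gM := min_half_width_geM; have g1 := min_half_width_lt1; have M0' := M0.
have cF : {within `[min_half_width, 1], continuous (Rfun M q)}.
  by apply: derivable_within_continuous => z _; have [] := is_derive_Rfun z.
have [g] := EVT_min (ltW g1) cF.
rewrite in_itv/= => /andP[gg gle1] gmn.
have gmn' x : min_half_width <= x -> x <= 1 -> Rfun M q g <= Rfun M q x.
  by move=> x1 x2; apply: gmn; rewrite in_itv/= x1.
(* Two minimizers enclose a critical point [c]; before [c] the derivative is negative, so R is
   smaller at [c] than at [a]. *)
have twice a b : min_half_width <= a -> a < b -> b <= 1 -> Rfun M q a = Rfun M q g ->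
    Rfun M q b = Rfun M q g -> False.
  move=> ga ab b1 Ra Rb.
  have [c /andP[ac cb]] := Rfun_mvt ab.
  rewrite Ra Rb subrr => /esym/eqP; rewrite mulf_eq0 [b - a == 0]gt_eqF ?subr_gt0// orbF => /eqP dc.
  have [d /andP[ad dc']] := Rfun_mvt ac => Rc.
  have Dd : Dfun d < 0.
    have cD : Dfun c <= 0 by rewrite leNgt -dRfun_gt0 dc ltxx.
    by apply: lt_le_trans cD; apply: Dfun_lt; lra.
  have : Rfun M q c < Rfun M q g.
    rewrite -Ra -subr_lt0 Rc pmulr_llt0; first by rewrite dRfun_lt0.
    by rewrite subr_gt0.
  by rewrite ltNge gmn'//; lra.
have incr a b : min_half_width <= a -> a < b -> b <= 1 -> 0 <= Dfun a -> Rfun M q a < Rfun M q b.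
  move=> ga ab b1 Da; have [c /andP[ac cb] E] := Rfun_mvt ab.
  rewrite -subr_gt0 E pmulr_lgt0 ?subr_gt0// dRfun_gt0.
  by apply: le_lt_trans Da _; apply: Dfun_lt; lra.
exists g; split => //.
- rewrite lt_neqAle gle1 andbT; apply/eqP => ge1.
  pose a := Num.max min_half_width (1 - M / 3).
  have ga : min_half_width <= a by rewrite /a le_max lexx.
  have a3 : 1 - M / 3 <= a by rewrite /a le_max lexx orbT.
  have a1 : a < 1 by rewrite /a gt_max g1/=; lra.
  have : Rfun M q a < Rfun M q 1.
    apply: incr => //; apply/ltW/Dfun_gt0_near1 => //; lra.
  by rewrite ltNge -{1}ge1 gmn'// ltW.
- move=> M1; apply/eqP; apply: contraT => gn0.
  have gm0 : min_half_width = 0 by apply/max_idPl; lra.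
  have gp : 0 < g by rewrite lt_neqAle eq_sym gn0/= -gm0.
  (* [Dfun 0 = M^2 * (M^2 - 1)]. *)
  have D0 : 0 <= Dfun 0.
    rewrite /Dfun mulr0 expr0n/= addr0 subr0 expr1n mulr1 mul1r.
    have : 1 <= M ^+ 2 by rewrite expr_ge1// ltW.
    nra.
  have : Rfun M q 0 < Rfun M q g by apply: incr; rewrite ?gm0.
  by rewrite ltNge gmn'// gm0.
- move=> x gx x1 xg; rewrite lt_neqAle gmn'// andbT; apply/eqP => E.
  by move: xg; rewrite neq_lt => /orP[] h; [apply: (twice x g)|apply: (twice g x)].
Qed.

End Rfun_theory.

(** * The lower bound and its equality case *)

Section tangent.
Context {R : realType}.
Implicit Types s t : R.

(* The tangent to [drag] at [t] is [s |-> tan_icpt t - tan_slope t * s]. *)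
Definition tan_icpt t := (1 + 3 * t ^+ 2) / (1 + t ^+ 2) ^+ 2.
Definition tan_slope t := 2 * t / (1 + t ^+ 2) ^+ 2.

(** For [t >= 1] and [s >= 0] the factor [2 * t * s + (t^2 - 1)] is nonnegative, and it vanishes
    only for [t = 1], [s = 0]: slopes 0 and 1 share a tangent. *)
Lemma drag_tangentE s t : drag s - (tan_icpt t - tan_slope t * s) =
  (s - t) ^+ 2 * (2 * t * s + (t ^+ 2 - 1)) / ((1 + s ^+ 2) * (1 + t ^+ 2) ^+ 2).
Proof.
rewrite /drag /tan_icpt /tan_slope.
have /negbT h1 := gt_eqF (drag_den_gt0 s); have /negbT h2 := gt_eqF (drag_den_gt0 t).
by field; rewrite h1 h2.
Qed.

Lemma tangent_at t : tan_icpt t - tan_slope t * t = drag t.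
Proof.
apply/esym/eqP; rewrite -subr_eq0 drag_tangentE subrr expr0n/= mul0r mul0r.
by [].
Qed.

Lemma drag_tangent_le s t : 1 <= t -> 0 <= s -> tan_icpt t - tan_slope t * s <= drag s.
Proof.
move=> t1 s0; rewrite -subr_ge0 drag_tangentE divr_ge0//.
  rewrite mulr_ge0 ?sqr_ge0// addr_ge0//; first by rewrite !mulr_ge0//; lra.
  by rewrite subr_ge0 expr_ge1//; lra.
by rewrite mulr_ge0 ?sqr_ge0// ltW// drag_den_gt0.
Qed.

Lemma drag_tangent_eq s t : 1 <= t -> 0 <= s -> drag s = tan_icpt t - tan_slope t * s ->
  s = t \/ s = 0.
Proof.
move=> t1 s0 /eqP; rewrite -subr_eq0 drag_tangentE.
have t2 : 1 <= t ^+ 2 by nra.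
rewrite !mulf_eq0 invr_eq0 mulf_eq0 !expf_eq0/= !(gt_eqF (drag_den_gt0 _)) !orbF.
move=> /orP[|/eqP H]; first by rewrite orbb subr_eq0 => /eqP ->; left.
right; have : 0 <= (t - 1) * s by rewrite mulr_ge0//; lra.
by lra.
Qed.

Lemma tan_icpt_ge0 t : 0 <= tan_icpt t.
Proof. by apply: divr_ge0; rewrite ?sqr_ge0//; have := sqr_ge0 t; lra. Qed.

Lemma tan_slope_ge0 t : 0 <= t -> 0 <= tan_slope t.
Proof. by move=> t0; apply: divr_ge0; rewrite ?sqr_ge0// mulr_ge0. Qed.

Lemma drag1 : drag 1 = 1 / 2 :> R.
Proof. by rewrite /drag expr1n; field. Qed.

End tangent.

Lemma le_flat_case {R : realType} (pG p1 N M G r cost : R) :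
  p1 - pG = 2 * N -> pG + (1 * (2 - 2 * G) - 1 / 2 * (2 * M)) + r <= cost ->
  p1 + M + 2 * ((1 - M - G) - N) + r <= cost.
Proof. lra. Qed.

Lemma gap_eq0 {R : realType} (A B r N W : R) :
  A <= B -> N <= W -> 0 <= r -> B + 2 * (W - N) + r <= A -> [/\ B <= A, r = 0 & N = W].
Proof. by move=> h1 h2 h3 h4; split; lra. Qed.

Section cost_bound.
Context {R : realType}.
Local Notation mu := (@lebesgue_measure R).
Variables (q M : R) (u p : R -> R).
Hypotheses (M0 : 0 < M) (q0 : 0 <= q) (q1 : q <= 1) (up : slope_sel q u p).
Hypothesis uM : forall x, -1 <= x <= 1 -> 0 <= u x <= M.

(** It measures how far the slopes on the ridge are from the points where the tangent touches
    [drag]. *)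
Definition ridge_gap (t e : R) := \int[mu]_(x in ridge u `&` inner_itv e)
  (drag (p x) - (tan_icpt t - tan_slope t * `|p x|)).

Lemma ridge_gap_ge0 t e : 1 <= t -> 0 <= ridge_gap t e.
Proof.
move=> t1; apply: Rintegral_ge0 => x _.
by rewrite subr_ge0 -[leRHS]drag_norm drag_tangent_le.
Qed.

Lemma msr_valley_le2 : msr (valley u) <= 2.
Proof.
rewrite -msr_oo11; apply: msr_le => //; last exact: valley_sub.
  exact: (measurable_valley q0 up).
exact: measurable_itv.
Qed.

Lemma cost_valley : parabola_cost q (msr (valley u) / 2) <= \int[mu]_(x in valley u) drag (p x).
Proof.
have V0 := msr_ge0 (valley u).
have := @valley_cost _ q u p q0 up (msr (valley u) / 2).
rewrite (_ : 2 * (msr (valley u) / 2) = msr (valley u)); last by rewrite mulrC divfK.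
rewrite subrr mul0r addr0 divr_ge0//; apply => // x Vx.
by have := valley_slope q0 up Vx; rewrite mulrA ler_pdivlMr// mulrC.
Qed.

Lemma cost_tangent t e : 1 <= t -> 0 < e < 1 ->
  parabola_cost q (msr (valley u) / 2) + (tan_icpt t * (2 - msr (valley u)) - tan_slope t * (2 * M))
    + ridge_gap t e <= \int[mu]_(x in oo11) drag (p x).
Proof.
move=> t1 e01; rewrite (cost_split q0 up).
have := ridge_cost q0 up uM (tan_icpt_ge0 t) (tan_slope_ge0 (le_trans ler01 t1)) e01
  (fun s => @drag_tangent_le _ s t t1).
rewrite (msr_ridge q0 up) -/(ridge_gap t e).
have := cost_valley.
set a := parabola_cost _ _; set b := Rintegral _ _ _; set c := Rintegral _ _ _.
set g := ridge_gap _ _; set i := tan_icpt _ * _; set k := tan_slope _ * _ => H1 H2.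
by rewrite -addrA; apply: lerD => //; rewrite addrC addrA.
Qed.

(** If half the valley, [G], is below [1 - M], the slope [M / (1 - G)] is below 1 and has no
    admissible tangent. The tangent at 1 then leaves a surplus, given by the mean value theorem,
    which vanishes only for [q = 0]; hence the second alternative. *)
Lemma cost_bound g : min_half_width M <= g -> g < 1 ->
  (forall x, min_half_width M <= x -> x <= 1 -> x != g -> Rfun M q g < Rfun M q x) ->
  Rfun M q g <= \int[mu]_(x in oo11) drag (p x) /\
  (\int[mu]_(x in oo11) drag (p x) <= Rfun M q g ->
   (forall e, 0 < e < 1 -> ridge_gap (M / (1 - g)) e = 0) /\
   (msr (valley u) = 2 * g \/ [/\ q = 0, g = 1 - M & valley u = set0])).
Proof.
move=> gg g1 gmn.
have gmn' x : min_half_width M <= x -> x <= 1 -> Rfun M q g <= Rfun M q x.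
  by move=> x0 x1; have [->//|xg] := eqVneq x g; exact/ltW/gmn.
set cost := \int[mu]_(x in oo11) drag (p x).
pose G := msr (valley u) / 2.
have VG : msr (valley u) = 2 * G by rewrite /G mulrC divfK.
have G0 : 0 <= G by rewrite divr_ge0// msr_ge0.
have G1 : G <= 1 by rewrite /G ler_pdivrMr// mul1r msr_valley_le2.
have half01 : 0 < (1 / 2 : R) < 1 by lra.
have ct t e : 1 <= t -> 0 < e < 1 ->
  parabola_cost q G + (tan_icpt t * (2 - 2 * G) - tan_slope t * (2 * M)) + ridge_gap t e <= cost.
  by move=> t1 e01; rewrite -VG; exact: cost_tangent.
have [GM|GM] := ltP G (1 - M).
  have gM : min_half_width M = 1 - M by apply/max_idPr; exact: le_trans G0 (ltW GM).
  have [c /andP[Gc cM] Ec] := parabola_cost_mvt q0 GM.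
  have R1 : Rfun M q (1 - M) = parabola_cost q (1 - M) + M.
    rewrite Rfun_drag//; last by rewrite gtrBl.
    by rewrite subKr divff ?gt_eqF// drag1; congr (_ + _); field.
  have M1 : M < 1 by rewrite -subr_gt0 (le_lt_trans G0).
  have RgM : Rfun M q g <= Rfun M q (1 - M).
    by apply: gmn'; [rewrite gM|rewrite gerBl ltW].
  have i1 : tan_icpt 1 = 1 :> R by rewrite /tan_icpt expr1n; field.
  have k1 : tan_slope 1 = 1 / 2 :> R by rewrite /tan_slope expr1n; field.
  have nfc : drag (q * c) * (1 - M - G) <= 1 - M - G.
    by rewrite ler_piMl// ?drag_le1// subr_ge0 ltW.
  have ct1 e : 0 < e < 1 -> Rfun M q (1 - M) + 2 * ((1 - M - G) - drag (q * c) * (1 - M - G))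
       + ridge_gap 1 e <= cost.
    move=> e01; have := ct 1 e (lexx _) e01; rewrite i1 k1 R1.
    by apply: le_flat_case; rewrite Ec mulrA.
  split.
    apply: le_trans RgM _; apply: le_trans (ct1 _ half01).
    by rewrite -addrA lerDl addr_ge0 ?ridge_gap_ge0// mulr_ge0// subr_ge0.
  move=> cg.
  have gap1 e : 0 < e < 1 -> [/\ Rfun M q (1 - M) <= Rfun M q g,
      ridge_gap 1 e = 0 & drag (q * c) * (1 - M - G) = 1 - M - G].
    move=> e01; apply: gap_eq0 RgM nfc (ridge_gap_ge0 e (lexx 1)) _.
    exact: le_trans (ct1 e e01) cg.
  have [R1g _ nf1c] := gap1 _ half01.
  have gE : g = 1 - M.
    apply/eqP; apply: contraT => gn; move: R1g; rewrite leNgt => /negP[].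
    by apply: gmn; rewrite ?gM// ?gerBl ?ltW// eq_sym.
  have q00 : q = 0.
    (* No surplus means [drag (q * c) = 1], that is [q * c = 0], whereas [c > G >= 0]. *)
    have qc : (q * c) ^+ 2 = 0.
      have W0 : 1 - M - G != 0 by rewrite gt_eqF// subr_gt0.
      have : drag (q * c) = 1 by apply: (mulIf W0); rewrite nf1c mul1r.
      rewrite /drag => /(congr1 (@GRing.inv R)); rewrite invrK invr1.
      by move=> h; apply: (@addrI _ 1); rewrite h addr0.
    apply/eqP; move/eqP: qc; rewrite expf_eq0/= mulf_eq0 => /orP[//|/eqP c0]; exfalso.
    by move: Gc; rewrite c0 => /(le_lt_trans G0); rewrite ltxx.
  split; last by right; split => //; exact: (valley_q0 up q00).
  move=> e e01; rewrite gE subKr divff ?gt_eqF//.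
  by have [] := gap1 e e01.
have gG : min_half_width M <= G by rewrite /min_half_width ge_max G0.
(* For [G = 1] no side slope exists; the cost of the valley alone is already R at 1, which exceeds
   the minimum. *)
have [Glt1|G1'] := ltP G 1; last first.
  have GE : G = 1 by apply/eqP; rewrite eq_le G1.
  have R1 : Rfun M q 1 <= cost.
    rewrite Rfun1 -GE; apply: le_trans cost_valley _.
    rewrite /cost (cost_split q0 up) lerDl; apply: Rintegral_ge0 => x _; exact: drag_ge0.
  have gR : Rfun M q g < Rfun M q 1.
    by apply: gmn => //; [exact/ltW/min_half_width_lt1|rewrite gt_eqF].
  split; first exact: le_trans (ltW gR) R1.
  by move=> /(le_trans R1); rewrite leNgt gR.
have t1 : 1 <= M / (1 - G) by rewrite ler_pdivlMr ?subr_gt0// mul1r lerBlDr addrC -lerBlDr.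
have RG e : 0 < e < 1 -> Rfun M q G + ridge_gap (M / (1 - G)) e <= cost.
  move=> e01; have := ct _ e t1 e01; rewrite Rfun_drag// -tangent_at.
  set t := M / (1 - G).
  suff -> : tan_icpt t * (2 - 2 * G) - tan_slope t * (2 * M) =
      2 * (1 - G) * (tan_icpt t - tan_slope t * t) by [].
  have -> : M = t * (1 - G) by rewrite divfK// gt_eqF// subr_gt0.
  by ring.
split.
  apply: le_trans (gmn' _ gG (ltW Glt1)) _; apply: le_trans (RG _ half01).
  by rewrite lerDl ridge_gap_ge0.
move=> cg.
have gE : G = g.
  apply/eqP; apply: contraT => Gg.
  have := gmn G gG (ltW Glt1) Gg; rewrite ltNge => /negP[].
  apply: le_trans cg; apply: le_trans (RG _ half01).
  by rewrite lerDl ridge_gap_ge0.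
split; last by left; rewrite VG gE.
move=> e e01; apply/eqP; rewrite eq_le -{2}gE ridge_gap_ge0// andbT.
by have := le_trans (RG e e01) cg; rewrite gE gerDl.
Qed.

End cost_bound.

(** * The optimal profile *)

Section profile.
Context {R : realType}.
Local Notation mu := (@lebesgue_measure R).
Variables (q M g : R).
Hypotheses (M0 : 0 < M) (q0 : 0 <= q) (q1 : q <= 1) (qM : q <= 2 * M).
Hypotheses (gg : min_half_width M <= g) (g1 : g < 1).

(** A minimum of three functions with second derivative at most [q]: the supergradient inequality at
    a point follows from the active piece alone. *)
Definition profile (x : R) : R :=
  Num.min (q / 2 * (x ^+ 2 - g ^+ 2) + M)
    (Num.min (M / (1 - g) * (1 - x)) (M / (1 - g) * (1 + x))).

Definition profile_slope (x : R) : R :=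
  if `|x| < g then q * x else if 0 <= x then - (M / (1 - g)) else M / (1 - g).

Lemma profile_g0 : 0 <= g.
Proof. exact: le_trans (min_half_width_ge0 M) gg. Qed.

Lemma side_slope_ge1 : 1 <= M / (1 - g).
Proof.
by rewrite ler_pdivlMr ?subr_gt0// mul1r lerBlDr addrC -lerBlDr (le_trans (min_half_width_geM M)).
Qed.

Lemma side_slopeE : M / (1 - g) * (1 - g) = M.
Proof. by rewrite divfK// gt_eqF// subr_gt0. Qed.

Lemma parabola_side x : M / (1 - g) * (1 - x) - (q / 2 * (x ^+ 2 - g ^+ 2) + M) =
  (g - x) * (M / (1 - g) + q / 2 * (g + x)).
Proof. by rewrite -{2}side_slopeE; ring. Qed.

Lemma profile_mid x : `|x| <= g -> profile x = q / 2 * (x ^+ 2 - g ^+ 2) + M.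
Proof.
rewrite ler_norml => /andP[x1 x2]; apply/min_idPl; rewrite le_min.
have t1 := side_slope_ge1; have q0' := q0.
apply/andP; split; rewrite -subr_ge0.
  rewrite parabola_side mulr_ge0 ?subr_ge0// addr_ge0//.
    exact: le_trans ler01 t1.
  by rewrite !mulr_ge0//; lra.
have := parabola_side (- x); rewrite opprK sqrrN => ->.
rewrite mulr_ge0//; first lra.
rewrite addr_ge0//; first exact: le_trans ler01 t1.
by rewrite !mulr_ge0//; lra.
Qed.

Lemma profile_side x : g <= `|x| -> `|x| <= 1 -> profile x = M / (1 - g) * (1 - `|x|).
Proof.
move=> gx x1; have t1 := side_slope_ge1; have q0' := q0; have g0 := profile_g0.
have key y : g <= y -> M / (1 - g) * (1 - y) <= q / 2 * (y ^+ 2 - g ^+ 2) + M.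
  move=> gy; rewrite -subr_le0 parabola_side mulr_le0_ge0 ?subr_le0//.
  rewrite addr_ge0//; first exact: le_trans ler01 t1.
  by rewrite !mulr_ge0//; lra.
rewrite /profile; set S := Num.min (_ * (1 - x)) _.
have -> : S = M / (1 - g) * (1 - `|x|).
  have [x0|x0] := leP 0 x.
    rewrite /S ger0_norm//; apply/min_idPl.
    by rewrite ler_wpM2l//; [exact: le_trans ler01 t1|lra].
  rewrite /S ltr0_norm// opprK; apply/min_idPr.
  by rewrite ler_wpM2l//; [exact: le_trans ler01 t1|lra].
by apply/min_idPr; have := key _ gx; rewrite real_normK ?num_real.
Qed.

(** The lowest point of the parabola is [M - q / 2 * g^2], and here [q <= 2 * M] enters. *)
Lemma profile_range x : -1 <= x <= 1 -> 0 <= profile x <= M.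
Proof.
move=> /andP[x1 x2]; have x11 : `|x| <= 1 by rewrite ler_norml x1.
have t1 := side_slope_ge1; have q0' := q0; have qM' := qM; have g0 := profile_g0; have g1' := g1.
have [xg|xg] := leP `|x| g.
  rewrite profile_mid//.
  have h1 : x ^+ 2 <= g ^+ 2 by rewrite -(real_normK (num_real x)) ler_pXn2r ?nnegrE.
  have h2 : g ^+ 2 <= 1 by rewrite expr_le1// ltW.
  have h3 := sqr_ge0 x.
  have h4 : 0 <= q / 2 * (g ^+ 2 - x ^+ 2) by rewrite mulr_ge0 ?divr_ge0// subr_ge0.
  have h5 : q / 2 * (g ^+ 2 - x ^+ 2) <= q / 2 * 1 by rewrite ler_wpM2l ?divr_ge0//; lra.
  apply/andP; split; lra.
rewrite (profile_side (ltW xg) x11); apply/andP; split.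
  by rewrite mulr_ge0 ?subr_ge0//; exact: le_trans ler01 t1.
by rewrite -[leRHS]side_slopeE ler_wpM2l//; [exact: le_trans ler01 t1|lra].
Qed.

Lemma profile_sel : slope_sel q profile profile_slope.
Proof.
move=> x y /andP[x1 x2] _; rewrite /profile_slope.
have x11 : `|x| <= 1 by rewrite ler_norml; lra.
have q0' := q0; have d0 := sqr_ge0 (y - x).
have qd : 0 <= q / 2 * (y - x) ^+ 2 by rewrite mulr_ge0// divr_ge0.
case: ifPn => [xg|]; last rewrite -leNgt => xg.
  rewrite (profile_mid (ltW xg)); apply: (@le_trans _ _ (q / 2 * (y ^+ 2 - g ^+ 2) + M)).
    by rewrite /profile ge_min lexx.
  lra.
rewrite (profile_side xg x11).
case: ifPn => [xp|]; last rewrite -ltNge => xn.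
  rewrite ger0_norm//; apply: (@le_trans _ _ (M / (1 - g) * (1 - y))).
    by rewrite /profile !ge_min lexx orbT.
  lra.
rewrite ltr0_norm//; apply: (@le_trans _ _ (M / (1 - g) * (1 + y))).
  by rewrite /profile !ge_min lexx !orbT.
lra.
Qed.

Lemma profile_cost : \int[mu]_(x in oo11) drag (profile_slope x) = Rfun M q g.
Proof.
have g0 := profile_g0; have g1' := g1.
have moo : measurable (oo11 : set R) by exact: measurable_itv.
pose B : set R := `]-g, g[%classic.
have mB : measurable B by exact: measurable_itv.
have B11 : B `<=` oo11.
  by move=> x; rewrite /B /oo11 /= !in_itv/= => /andP[? ?]; apply/andP; split; lra.
have U : oo11 = B `|` (oo11 `\` B) by rewrite setDUK.
rewrite U Rintegral_setU//.
- rewrite Rfun_drag//; congr (_ + _).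
    rewrite -integral_parabola_cost//; apply: eq_Rintegral => x /set_mem.
    by rewrite /B /= in_itv/= -ltr_norml /profile_slope => ->.
  transitivity (\int[mu]_(x in oo11 `\` B) (drag (M / (1 - g)))).
    apply: eq_Rintegral => x /set_mem[_].
    rewrite /B /= in_itv/= -ltr_norml => /negP/negbTE xg.
    by rewrite /profile_slope xg; case: ifP => // _; rewrite dragN.
  rewrite Rintegral_cst; last exact: measurableD.
  rewrite -/(msr _) msr_setD// /B msr_itv; last lra.
  by rewrite mulrC; congr (_ * _); ring.
- exact: measurableD.
- by rewrite -U; exact: (drag_sel_integrable profile_sel).
- by rewrite disj_set2E setDIK.
Qed.

Lemma profile_K : K M q profile.
Proof. by split; [exact: profile_range|exact: slope_sel_q_concave profile_sel]. Qed.

Lemma profile_resistance : resistance profile = (Rfun M q g)%:E.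
Proof. by rewrite (resistance_sel q0 profile_sel) profile_cost. Qed.

End profile.

(** * Uniqueness *)

Section rigidity.
Context {R : realType}.
Implicit Types (q c t : R) (u p : R -> R).

Lemma le_small (A B C d0 : R) : 0 < d0 ->
  (forall d, 0 < d -> d < d0 -> A <= B + C * d) -> A <= B.
Proof.
move=> d00 H; apply/ler_addgt0Pr => e e0.
have C1 : 0 < `|C| + 1 by rewrite ltr_wpDl.
pose d := Num.min (d0 / 2) (e / (`|C| + 1)).
have dp : 0 < d by rewrite lt_min !divr_gt0.
have dd0 : d < d0.
  apply: (@le_lt_trans _ _ (d0 / 2)); first by rewrite /d ge_min lexx.
  by rewrite ltr_pdivrMr// ltr_pMr// ltr1n.
apply: le_trans (H d dp dd0) _; rewrite lerD2l.
have de : d * (`|C| + 1) <= e by rewrite -ler_pdivlMr// /d ge_min lexx orbT.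
apply: le_trans de; rewrite mulrC ler_pM2l//.
by apply: le_trans (ler_norm C) _; rewrite lerDl.
Qed.

(** The supergradients at both ends give the increment up to [q / 2 * (y - x)^2] in either
    direction; bisection removes this error. *)
Lemma sel_affine q u p a b t : slope_sel q u p -> -1 <= a -> b <= 1 ->
  (forall z, a < z < b -> p z = t) ->
  forall x y, a < x -> x <= y -> y < b -> u y - u x = t * (y - x).
Proof.
move=> up a1 b1 pt x y ax xy yb.
have H (s : R) : s = 1 \/ s = -1 -> s * (u y - u x - t * (y - x)) <= 0.
  move=> s1.
  apply: (@halving_le0 _ (fun x y => s * (u y - u x - t * (y - x))) (fun z => - (q / 2 * z)) x y xy).
    by move=> x' y' z' _ _ _ _; lra.
  move=> x' y' xx' x'y' y'y.
  have px : p x' = t by apply: pt; lra.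
  have py : p y' = t by apply: pt; lra.
  have H1 : u y' <= u x' + p x' * (y' - x') + q / 2 * (y' - x') ^+ 2 by apply: up; lra.
  have H2 : u x' <= u y' + p y' * (x' - y') + q / 2 * (x' - y') ^+ 2 by apply: up; lra.
  rewrite px in H1; rewrite py in H2.
  by case: s1 => ->; lra.
have H1 := H 1 (or_introl erefl); have H2 := H (-1) (or_intror erefl).
by apply/eqP; rewrite eq_le; apply/andP; split; lra.
Qed.

(* [p] has no upward jumps, so passing from [<= c] to [> c] it would stay in
   ]c, t[ on an interval. *)
Lemma no_crossing q p c t : 0 <= q -> 0 <= c -> c < t ->
  (forall x y, -1 < x -> x <= y -> y < 1 -> p y - p x <= q * (y - x)) ->
  (forall a b, -1 <= a -> a < b -> b <= 1 ->
     exists2 z, a < z < b & ~ (c < `|p z| /\ `|p z| != t)) ->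
  forall x y, -1 < x -> x <= y -> y < 1 -> c < p y -> c < p x.
Proof.
move=> q0 c0 ct rate noint x y x1 xy y1 cpy.
rewrite ltNge; apply/negP => pxc.
pose S := [set z | x <= z <= y /\ p z <= c].
have Sx : S x by split => //; rewrite lexx.
have S0 : S !=set0 by exists x.
have ubS : has_ubound S by exists y => z [/andP[]].
pose s := sup S.
have xs : x <= s by exact: ub_le_sup.
have sy : s <= y by apply: ge_sup => // z [/andP[]].
(* The supremum need not belong to [S], so the growth bound is applied from points of [S] close to
   it. *)
have ps z : s <= z -> z <= y -> p z <= c + q * (z - s).
  move=> sz zy; suff : q * s <= c + q * z - p z by lra.
  apply/ler_addgt0Pr => e e0.
  have q1 : 0 < q + 1 by rewrite ltr_wpDl.
  have [w Sw sw] := sup_adherent (divr_gt0 e0 q1) (conj S0 ubS).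
  have [/andP[xw wy] pw] := Sw.
  have ws : w <= s by exact: ub_le_sup.
  have := rate w z (lt_le_trans x1 xw) (le_trans ws sz) (le_lt_trans zy y1).
  have : (s - w) * (q + 1) <= e by rewrite -ler_pdivlMr// lerBlDr -lerBlDl ltW.
  have : 0 <= s - w by rewrite subr_ge0.
  lra.
have sly : s < y.
  rewrite lt_neqAle sy andbT; apply/eqP => sy'.
  by have := ps y; rewrite sy' lexx subrr mulr0 addr0 => /(_ isT isT); rewrite leNgt cpy.
(* So short that on ]s, s + d[ the slope has not yet reached [t]; it exceeds [c] there, being past
   the supremum of [S]. *)
pose d := Num.min (y - s) ((t - c) / (q + 1)).
have q1 : 0 < q + 1 by rewrite ltr_wpDl.
have d0 : 0 < d by rewrite lt_min subr_gt0 sly divr_gt0// subr_gt0.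
have dy : d <= y - s by rewrite /d ge_min lexx.
have dt : d * (q + 1) <= t - c by rewrite -ler_pdivlMr// /d ge_min lexx orbT.
have [|||z /andP[z1 z2]] := noint s (s + d); [lra|lra|lra|].
apply; have zy : z <= y by lra.
have cz : c < p z.
  rewrite ltNge; apply/negP => pz; have Sz : S z by split => //; lra.
  by have := ub_le_sup ubS Sz; rewrite leNgt z1.
rewrite ger0_norm ?(le_trans c0 (ltW cz))//; split => //.
rewrite lt_eqF//.
have := ps z (ltW z1) zy.
have : q * (z - s) <= q * d by rewrite ler_wpM2l//; lra.
lra.
Qed.

(** A slope below [t] stays below [t] for a while to the right, and one above [t] was above [t] for
    a while to the left. Either would fill an interval with forbidden slopes. *)
Lemma slope_const q p c t a b : 0 <= q -> 0 <= c -> -1 <= a -> b <= 1 ->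
  (forall x y, -1 < x -> x <= y -> y < 1 -> p y - p x <= q * (y - x)) ->
  (forall a b, -1 <= a -> a < b -> b <= 1 ->
     exists2 z, a < z < b & ~ (c < `|p z| /\ `|p z| != t)) ->
  (forall z, a < z < b -> c < p z) -> forall z, a < z < b -> p z = t.
Proof.
move=> q0 c0 a1 b1 rate noint cp z zab; have /andP[az zb] := zab.
have q1 : 0 < q + 1 by rewrite ltr_wpDl.
have good w : a < w < b -> p w = t \/ (c < `|p w| /\ `|p w| != t).
  move=> wab; have cw := cp w wab.
  have [<-|pt] := eqVneq (p w) t; [by left|right].
  by rewrite ger0_norm ?(le_trans c0 (ltW cw)).
case: (ltgtP (p z) t) => // pz.
  pose d := Num.min (b - z) ((t - p z) / (q + 1)).
  have d0 : 0 < d by rewrite lt_min subr_gt0 zb divr_gt0// subr_gt0.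
  have dy : d <= b - z by rewrite /d ge_min lexx.
  have dt : d * (q + 1) <= t - p z by rewrite -ler_pdivlMr// /d ge_min lexx orbT.
  have [|||w /andP[z1 z2]] := noint z (z + d); [lra|lra|lra|].
  have wab : a < w < b by lra.
  case: (good w wab) => // pw _.
  have := rate z w (le_lt_trans a1 az) (ltW z1) (lt_le_trans (andP wab).2 b1).
  have : q * (w - z) <= q * d by rewrite ler_wpM2l//; lra.
  lra.
pose d := Num.min (z - a) ((p z - t) / (q + 1)).
have d0 : 0 < d by rewrite lt_min subr_gt0 az divr_gt0// subr_gt0.
have dy : d <= z - a by rewrite /d ge_min lexx.
have dt : d * (q + 1) <= p z - t by rewrite -ler_pdivlMr// /d ge_min lexx orbT.
have [|||w /andP[z1 z2]] := noint (z - d) z; [lra|lra|lra|].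
have wab : a < w < b by lra.
case: (good w wab) => // pw _.
have := rate w z (le_lt_trans a1 (andP wab).1) (ltW z2) (lt_le_trans zb b1).
have : q * (z - w) <= q * d by rewrite ler_wpM2l//; lra.
lra.
Qed.

(* Since [u x0 <= M = u g], a slope as small as [- q * (g - d)] at [x0] forces
   [x0] to lie within [2 * d] of [- g], and the supergradient inequality there
   bounds [u] by the parabola. *)
Lemma parabola_upper q u p M g d x0 y : 0 < q -> q <= 1 -> 0 <= g -> g < 1 ->
  slope_sel q u p -> u g = M -> u x0 <= M -> - g <= x0 -> x0 < g ->
  0 < d -> p x0 <= - (q * (g - d)) -> - g + 2 * d <= y -> y <= g ->
  u y <= q / 2 * (y ^+ 2 - g ^+ 2) + M + 4 * d.
Proof.
move=> q0 q1 g0 g1 up ug ux0 gx0 x0g d0 px0 gy yg.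
have H1 : u g <= u x0 + p x0 * (g - x0) + q / 2 * (g - x0) ^+ 2 by apply: up; lra.
have H2 : u y <= u x0 + p x0 * (y - x0) + q / 2 * (y - x0) ^+ 2 by apply: up; lra.
have x0d : x0 <= - g + 2 * d.
  have H3 : 0 <= (p x0 + q / 2 * (g - x0)) * (g - x0) by lra.
  have : 0 <= p x0 + q / 2 * (g - x0) by rewrite -(pmulr_lge0 _ (_ : 0 < g - x0))//; lra.
  move=> H4; have : 0 <= q * ((d - g) + (g - x0) / 2) by lra.
  by rewrite pmulr_rge0//; lra.
pose e := x0 + g; pose w := 2 * d - e; pose Y := y + g; pose Z := y - g.
have e0 : 0 <= e by rewrite /e; lra.
have w0 : 0 <= w by rewrite /w /e; lra.
have H5 : u y <= M + - (q * (g - d)) * (y - x0) + q / 2 * (y - x0) ^+ 2.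
  apply: le_trans H2 _; rewrite lerD2r; apply: lerD => //.
  by rewrite ler_wpM2r//; lra.
have H6 : M + - (q * (g - d)) * (y - x0) + q / 2 * (y - x0) ^+ 2 =
    q / 2 * (y ^+ 2 - g ^+ 2) + M + q / 2 * (Y * w - e * Z - e * w).
  by rewrite /Y /Z /w /e; field.
rewrite H6 in H5; apply: le_trans H5 _; rewrite lerD2l.
(* The products in [H7] and [H8] are at most [4 * d] each; with the factor [q / 2] and [q <= 1] this
   becomes the [4 * d] of the statement. *)
have H7 : Y * w <= 2 * (2 * d) by apply: ler_pM => //; rewrite /Y /w /e; lra.
have H8 : e * (- Z) <= (2 * d) * 2 by apply: ler_pM => //; rewrite /Z /e; lra.
have H9 : 0 <= e * w by rewrite mulr_ge0.
have H10 : Y * w - e * Z - e * w <= 8 * d by lra.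
apply: (@le_trans _ _ (q / 2 * (8 * d))); first by rewrite ler_pM2l// divr_gt0.
have : q * d <= 1 * d by rewrite ler_pM2r.
lra.
Qed.

End rigidity.

Lemma flat_excess {R : realType} (P W e n g : R) : P <= W ->
  W + (e + n * (2 - 2 * g - e)) = P + 2 * (1 - g) * n -> e * (1 - n) <= 0.
Proof. lra. Qed.

Lemma valley_excess {R : realType} (P W n g : R) :
  W + (0 + n * (2 - 2 * g - 0)) = P + 2 * (1 - g) * n -> W <= P.
Proof. lra. Qed.

Lemma flat_excess_q0 {R : realType} (e g : R) :
  0 + (e + 1 / 2 * (2 - 0 - e)) = 2 * g + 2 * (1 - g) * (1 / 2) -> 0 + e = 2 * g.
Proof. lra. Qed.

(** In the equality case this set, up to its ends, is the middle interval of the solution. It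
    replaces the valley, which is empty for [q = 0]. *)
Definition flat {R : realType} (q g : R) (p : R -> R) : set R :=
  oo11 `&` [set x | `|p x| <= q * g].

Lemma measurable_flat {R : realType} (q g : R) (u p : R -> R) :
  slope_sel q u p -> measurable (flat q g p).
Proof.
move=> up.
have -> : flat q g p = oo11 `&` (fun x => `|p x|) @^-1` `]-oo, q * g].
  by apply/seteqP; split => x [x11 /=]; rewrite in_itv/=.
have : measurable_fun oo11 (fun x => `|p x|).
  by apply: measurableT_comp => //; exact: (sel_measurable up).
by apply => //; exact: measurable_itv.
Qed.

Section equality.
Context {R : realType}.
Local Notation mu := (@lebesgue_measure R).
Variables (q M g : R) (u p : R -> R).
Hypotheses (M0 : 0 < M) (q0 : 0 <= q) (q1 : q <= 1) (up : slope_sel q u p).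
Hypothesis uM : forall x, -1 <= x <= 1 -> 0 <= u x <= M.
Hypotheses (gg : min_half_width M <= g) (g1 : g < 1).
Hypothesis gmn : forall x, min_half_width M <= x -> x <= 1 -> x != g -> Rfun M q g < Rfun M q x.
Hypothesis cost_le : \int[mu]_(x in oo11) drag (p x) <= Rfun M q g.

Let t := M / (1 - g).
Let phi x := drag (p x) - (tan_icpt t - tan_slope t * `|p x|).

Let t1 : 1 <= t. Proof. exact: side_slope_ge1. Qed.
Let g0 : 0 <= g. Proof. exact: profile_g0 gg. Qed.

Let cost_eq : \int[mu]_(x in oo11) drag (p x) = Rfun M q g.
Proof.
apply/eqP; rewrite eq_le cost_le.
by have [-> _] := cost_bound M0 q0 up uM gg g1 gmn.
Qed.

Let gap0 e : 0 < e < 1 -> ridge_gap u p t e = 0.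
Proof. by have [_ /(_ cost_le)[H _]] := cost_bound M0 q0 up uM gg g1 gmn; exact: H. Qed.

Let valley_alt : msr (valley u) = 2 * g \/ [/\ q = 0, g = 1 - M & valley u = set0].
Proof. by have [_ /(_ cost_le)[_ H]] := cost_bound M0 q0 up uM gg g1 gmn. Qed.

Let mV : measurable (valley u). Proof. exact: (measurable_valley q0 up). Qed.
Let mE : measurable (ridge u). Proof. exact: (measurable_ridge q0 up). Qed.
Let moo : measurable (oo11 : set R). Proof. exact: measurable_itv. Qed.

Let mp (A : set R) : measurable A -> A `<=` oo11 -> measurable_fun A p.
Proof. by move=> mA A11; exact: (measurable_funS moo A11 (sel_measurable up)). Qed.

Let mphi (A : set R) : measurable A -> A `<=` oo11 -> measurable_fun A phi.
Proof.
move=> mA A11; have mpA := mp mA A11.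
apply: measurable_funB; first exact: measurable_drag.
apply: measurable_funB => //; apply: measurable_funM => //.
exact: measurableT_comp.
Qed.

Let off_tangent : set R := ridge u `&` [set x | phi x != 0].

Let moff_tangent : measurable off_tangent.
Proof.
have -> : off_tangent = ridge u `&` phi @^-1` (~` [set 0]).
  by apply/seteqP; split => x [Ex /eqP].
apply: mphi => //; first exact: ridge_sub.
by apply: measurableC; exact: measurable_set1.
Qed.

(** A nonnegative function with zero integral ([gap0]) vanishes almost everywhere. *)
Lemma off_tangent_inner e : 0 < e < 1 -> mu (off_tangent `&` inner_itv e) = 0%E.
Proof.
move=> e01; set A := ridge u `&` inner_itv e.
have mA : measurable A by apply: measurableI => //; exact: measurable_itv.
have A11 : A `<=` oo11 by move=> x [/ridge_sub].
have phi0 x : 0 <= phi x by rewrite subr_ge0 -[leRHS]drag_norm drag_tangent_le.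
have [C C0 pC] := sel_bounded q0 up e01.
have k0 := tan_slope_ge0 (le_trans ler01 t1).
have iphi : mu.-integrable A (EFin \o phi).
  apply: (@bounded_integrable _ _ _ (1 + (tan_icpt t + tan_slope t * C))) => //; first exact: mphi.
  move=> x [_ /pC px]; apply: le_trans (ler_normB _ _) _; apply: lerD.
    by rewrite ger0_norm ?drag_ge0// drag_le1.
  apply: le_trans (ler_normB _ _) _; rewrite ger0_norm ?tan_icpt_ge0// lerD2l.
  by rewrite normrM normr_id (ger0_norm k0) ler_wpM2l.
have int0 : (\int[mu]_(x in A) `|(phi x)%:E| = 0)%E.
  transitivity (\int[mu]_(x in A) (phi x)%:E)%E.
    by apply: eq_integral => x _; rewrite gee0_abs// lee_fin.
  have fi : (\int[mu]_(x in A) (phi x)%:E)%E \is a fin_num by exact: integrable_fin_num.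
  rewrite -(fineK fi).
  by congr EFin; exact: (gap0 e01).
have /(ae_eq_integral_abs mu mA (measurable_int _ iphi)) [N [mN N0 AN]] := int0.
apply/eqP; rewrite -measure_le0 -N0; apply: le_measure; rewrite ?inE//.
  by apply: measurableI => //; exact: measurable_itv.
move=> x [[Ex /= px] Jx]; apply: AN => /= H.
have /eqP := H (conj Ex Jx).
by rewrite eqe (negbTE px).
Qed.

Lemma off_tangent_null : mu off_tangent = 0%E.
Proof.
have N11 : off_tangent `<=` oo11 by move=> x [/ridge_sub].
rewrite msrE//; congr EFin; apply/eqP; rewrite eq_le msr_ge0 andbT.
apply: (@le_small _ _ _ 2 1) => // e e0 e1.
have e01 : 0 < e < 1 by rewrite e0.
rewrite add0r -msr_inner_compl//.
have mC : measurable (oo11 `\` inner_itv e : set R).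
  by apply: measurableD => //; exact: measurable_itv.
have C11 : oo11 `\` inner_itv e `<=` (oo11 : set R) by move=> x [].
rewrite -lee_fin -!msrE//.
have -> : mu (oo11 `\` inner_itv e) = (mu (off_tangent `&` inner_itv e) + mu (oo11 `\` inner_itv e))%E.
  by rewrite off_tangent_inner// add0e.
have mI : measurable (off_tangent `&` inner_itv e) by apply: measurableI => //; exact: measurable_itv.
have := measureU2 mu mI mC; apply: le_trans.
apply: le_measure; rewrite ?inE//; first exact: measurableU.
move=> x Nx; have [Jx|Jx] := pselect (inner_itv e x); [left|right]; split => //.
exact: N11.
Qed.

Lemma ridge_slope x : ridge u x -> ~ off_tangent x -> `|p x| = t \/ p x = 0.
Proof.
move=> Ex /not_andP[//|/negP]; rewrite negbK subr_eq0 => /eqP.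
rewrite -[drag _]drag_norm => /(drag_tangent_eq t1 (normr_ge0 _))[->|/eqP]; [by left|].
by rewrite normr_eq0 => /eqP; right.
Qed.

Let qg_lt_t : q * g < t.
Proof.
apply: lt_le_trans t1; apply: (@le_lt_trans _ _ g) => //.
by rewrite -[leRHS]mul1r ler_wpM2r.
Qed.

Let valley_bound x : valley u x -> `|p x| <= q * g.
Proof.
move=> Vx; have [Vg|[_ _ V0]] := valley_alt; last by move: Vx; rewrite V0.
have := valley_slope q0 up Vx; rewrite Vg mulrCA.
by rewrite ler_pM2l.
Qed.

Let flat := flat q g p.

Let mflat : measurable flat. Proof. exact: (measurable_flat g up). Qed.

Let E0 := ridge u `&` flat.

Let mE0 : measurable E0. Proof. exact: measurableI. Qed.

Let Rint_off_tangent (A : set R) (c : R) : measurable A -> A `<=` ridge u ->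
  (forall x, A x -> ~ off_tangent x -> drag (p x) = c) -> \int[mu]_(x in A) drag (p x) = c * msr A.
Proof.
move=> mA AE Ac; have A11 : A `<=` oo11 by move=> x /AE /ridge_sub.
have iA : mu.-integrable A (EFin \o (fun x => drag (p x))) by exact: (drag_sel_integrable up).
rewrite (Rint_negligible mA moff_tangent off_tangent_null iA) /msr -Rintegral_cst//.
have iC : mu.-integrable A (EFin \o (fun=> c)) by apply: (@bounded_integrable _ _ _ `|c|).
rewrite (Rint_negligible mA moff_tangent off_tangent_null iC).
by apply: eq_Rintegral => x /set_mem[Ax Nx]; exact: Ac.
Qed.

(** Up to a null set the slope on the ridge is 0, at cost 1, or [t] in absolute value. As
    [q * g < t], only the former belongs to [flat]. *)
Let cost_ridge : \int[mu]_(x in ridge u) drag (p x) =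
  msr E0 + drag t * (2 - msr (valley u) - msr E0).
Proof.
have mD : measurable (ridge u `\` flat) by exact: measurableD.
have U : ridge u = E0 `|` (ridge u `\` flat) by rewrite setUIDK.
rewrite [in LHS]U Rintegral_setU//; last 2 first.
- by rewrite -U; apply: (drag_sel_integrable up) => //; exact: ridge_sub.
- by rewrite disj_set2E; apply/eqP/seteqP; split => // x [[_ ?] []].
rewrite (@Rint_off_tangent E0 1)//; last 2 first.
- by move=> x [].
- move=> x [Ex [_ px]] Nx; have [pt|->] := ridge_slope Ex Nx.
    by move: px; rewrite /= pt leNgt qg_lt_t.
  by rewrite /drag expr0n addr0 invr1.
rewrite (@Rint_off_tangent (ridge u `\` flat) (drag t))//; last first.
  move=> x [Ex nZ] Nx; have [<-|p0] := ridge_slope Ex Nx; first by rewrite drag_norm.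
  exfalso; apply: nZ; split; first exact: ridge_sub Ex.
  by rewrite /= p0 normr0 mulr_ge0.
rewrite mul1r; congr (_ + _ * _).
rewrite -(msr_ridge q0 up) [in RHS]U.
have F (A : set R) : measurable A -> A `<=` ridge u -> mu A \is a fin_num.
  by move=> mA AE; apply: mu_sub_fin => // x /AE /ridge_sub.
have FE0 : mu E0 \is a fin_num by apply: F => // x [].
have FD : mu (ridge u `\` flat) \is a fin_num by apply: F => // x [].
rewrite {2}/msr measureU//; last by apply/seteqP; split => // x [[_ ?] []].
by rewrite fineD// addrAC subrr add0r.
Qed.

Let nft_lt1 : drag t < 1.
Proof.
have := drag_lt 0 t; rewrite normr0 {1}(_ : drag 0 = 1); last by rewrite /drag expr0n addr0 invr1.
by move=> ->; rewrite normr_gt0 gt_eqF// (lt_le_trans ltr01).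
Qed.

(** If the valley has length [2 * g], any slope 0 on the ridge would cost more than [drag t], so
    [E0] is null. In the other alternative [t = 1], and the total cost itself determines the length
    of the plateau. *)
Lemma msr_flat : msr flat = 2 * g /\
  (msr (valley u) = 2 * g -> \int[mu]_(x in valley u) drag (p x) <= parabola_cost q g).
Proof.
have flatE : msr flat = msr (valley u) + msr E0.
  have U : flat = valley u `|` E0.
    apply/seteqP; split => x.
      move=> Zx; have [Vx|Vx] := pselect (valley u x); [by left|right].
      by split => //; split => //; exact: Zx.1.
    by move=> [Vx|[]//]; split; [exact: valley_sub Vx|exact: valley_bound].
  rewrite U /msr measureU//; last by apply/seteqP; split => // x [? [[]]].
  by rewrite fineD// mu_sub_fin//; [exact: valley_sub|move=> x [/ridge_sub]].
have := cost_eq; rewrite (cost_split q0 up) cost_ridge.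
have e0 := msr_ge0 E0; have V0 := msr_ge0 (valley u).
have [Vg|[qq0 gM Vs]] := valley_alt.
  have := cost_valley q0 up; rewrite Vg [2 * g]mulrC mulfK// [g * 2]mulrC.
  rewrite Rfun_drag// -/t; set W := Rintegral _ _ _ => H1 H2.
  have H3 : msr E0 * (1 - drag t) <= 0 by exact: flat_excess H1 H2.
  have E00 : msr E0 = 0.
    apply/eqP; rewrite eq_le e0 andbT; move: H3.
    by rewrite pmulr_lle0// subr_gt0.
  split; first by rewrite flatE Vg E00 addr0.
  by move=> _; rewrite E00 in H2; exact: valley_excess H2.
have t11 : t = 1 by rewrite /t gM subKr divff// gt_eqF.
have m0 : msr (set0 : set R) = 0 by rewrite /msr measure0.
rewrite flatE Vs Rintegral_set0 m0 Rfun_drag// -/t t11 drag1.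
rewrite (_ : parabola_cost q g = 2 * g); last by rewrite /parabola_cost qq0 ltxx.
move=> H; split; first exact: flat_excess_q0.
by move=> <-.
Qed.

(** An interval of such slopes would avoid the valley, whose slopes are at most [q * g], and so lie
    in the null set [off_tangent]. *)
Lemma no_bad_interval a b : -1 <= a -> a < b -> b <= 1 ->
  exists2 z, a < z < b & ~ (q * g < `|p z| /\ `|p z| != t).
Proof.
move=> a1 ab b1; apply: contrapT => H.
have : `]a, b[ `<=` off_tangent.
  move=> z /=; rewrite in_itv/= => zab; apply: contrapT => Nz.
  apply: H; exists z => // -[zg zt].
  have z11 : oo11 z by rewrite /oo11 /= in_itv/=; lra.
  have Ez : ridge u z by split => // /valley_bound; rewrite leNgt zg.
  have [pt|p0] := ridge_slope Ez Nz; first by rewrite pt eqxx in zt.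
  by move: zg; rewrite p0 normr0 ltNge mulr_ge0.
move=> abN; have : (mu `]a, b[ <= mu off_tangent)%E by apply: le_measure; rewrite ?inE//; exact: measurable_itv.
rewrite off_tangent_null lebesgue_measure_itv/= lte_fin ab -EFinB lee_fin; lra.
Qed.

End equality.

Section sides.
Context {R : realType}.

(** The climb [t * (1 - g) = M] uses up the whole range [0, M], which pins the affine piece. The
    values at -1 and [- g] come from supergradient inequalities at [-1 + d] and at [- g]. *)
Lemma left_side (q M g t : R) (u p : R -> R) : 0 <= q -> q <= 1 -> slope_sel q u p ->
  (forall x, -1 <= x <= 1 -> 0 <= u x <= M) -> 0 <= g -> g < 1 -> 1 <= t ->
  t * (1 - g) = M -> (forall z, -1 < z < - g -> p z = t) ->
  forall x, -1 <= x <= - g -> u x = t * (1 + x).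
Proof.
move=> q0 q1 up uM g0 g1 t1 tg pt.
have aff := sel_affine up (lexx (-1)) (_ : - g <= 1) pt.
have {}aff x y : -1 < x -> x <= y -> y < - g -> u y - u x = t * (y - x).
  by apply: aff; lra.
have uge x : -1 <= x -> x <= 1 -> 0 <= u x by move=> x1 x2; have /andP[] := uM x (introT andP (conj x1 x2)).
have ule x : -1 <= x -> x <= 1 -> u x <= M by move=> x1 x2; have /andP[] := uM x (introT andP (conj x1 x2)).
have inner x : -1 < x -> x < - g -> u x = t * (1 + x).
  move=> x1 xg; apply/eqP; rewrite eq_le; apply/andP; split.
    apply: (@le_small _ _ _ t (- g - x)); first by rewrite subr_gt0.
    move=> d d0 dx.
    have H1 : u (- g - d) - u x = t * (- g - d - x) by apply: aff; lra.
    have H2 : u (- g - d) <= M by apply: ule; lra.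
    lra.
  apply: (@le_small _ _ _ t (1 + x)); first lra.
  move=> d d0 dx.
  have H1 : u x - u (-1 + d) = t * (x - (-1 + d)) by apply: aff; lra.
  have H2 : 0 <= u (-1 + d) by apply: uge; lra.
  lra.
move=> x /andP[]; rewrite le_eqVlt => /predU1P[<- _|x1].
  have m11 : (-1 : R) <= 1 by lra.
  have u1 := uge (-1) (lexx _) m11.
  rewrite subrr mulr0; apply/eqP; rewrite eq_le u1 andbT.
  apply: (@le_small _ _ _ 1 (1 - g)); first by rewrite subr_gt0.
  move=> d d0 dg.
  have H1 : u (-1) <= u (-1 + d) + p (-1 + d) * (-1 - (-1 + d)) + q / 2 * (-1 - (-1 + d)) ^+ 2.
    by apply: up; [lra|rewrite lexx; lra].
  have H2 : u (-1 + d) = t * (1 + (-1 + d)) by apply: inner; lra.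
  have H3 : p (-1 + d) = t by apply: pt; lra.
  rewrite H2 H3 in H1.
  have H4 : q * (d * d) <= 1 * (1 * d) by apply: ler_pM => //; [nra|rewrite ler_pM2r//; lra].
  lra.
rewrite le_eqVlt => /predU1P[->|]; last exact: inner.
have ug : u (- g) <= M by apply: ule; lra.
rewrite tg; apply/eqP; rewrite eq_le ug /=.
apply: (@le_small _ _ _ (t + `|p (- g)| + 1) (1 - g)); first by rewrite subr_gt0.
move=> d d0 dg.
have H1 : u (- g - d) <= u (- g) + p (- g) * (- g - d - - g) + q / 2 * (- g - d - - g) ^+ 2.
  by apply: up; lra.
have H2 : u (- g - d) = t * (1 + (- g - d)) by apply: inner; lra.
have H4 : q * (d * d) <= 1 * (1 * d) by apply: ler_pM => //; [nra|rewrite ler_pM2r//; lra].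
have H5 : - p (- g) * d <= `|p (- g)| * d by rewrite ler_pM2r// -normrN ler_norm.
lra.
Qed.

Lemma left_end (q M g t a : R) (u p : R -> R) : slope_sel q u p ->
  (forall x, -1 <= x <= 1 -> 0 <= u x <= M) -> 0 <= g -> g < 1 -> 1 <= t ->
  t * (1 - g) = M -> a <= 1 -> (forall z, -1 < z < a -> p z = t) -> a <= - g.
Proof.
move=> up uM g0 g1 t1 tg a1 pt; rewrite leNgt; apply/negP => ga.
(* After removing [d] at both ends the interval is still longer than [1 - g], so the climb exceeds
   [M]. *)
pose d := (a + g) / 4.
have d0 : 0 < d by rewrite /d; lra.
have d1 : 4 * d = a + g by rewrite /d; lra.
have H : u (a - d) - u (-1 + d) = t * (a - d - (-1 + d)).
  by apply: (sel_affine up (lexx (-1)) a1 pt); lra.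
have /andP[_ H1] : 0 <= u (a - d) <= M by apply: uM; lra.
have /andP[H2 _] : 0 <= u (-1 + d) <= M by apply: uM; lra.
have H3 : t * (1 - g) < t * (a - d - (-1 + d)) by rewrite ltr_pM2l; lra.
lra.
Qed.

End sides.

Section uniqueness.
Context {R : realType}.
Local Notation mu := (@lebesgue_measure R).
Variables (q M g : R) (u p : R -> R).
Hypotheses (M0 : 0 < M) (q0 : 0 <= q) (q1 : q <= 1) (up : slope_sel q u p).
Hypothesis uM : forall x, -1 <= x <= 1 -> 0 <= u x <= M.
Hypotheses (gg : min_half_width M <= g) (g1 : g < 1).
Hypothesis gmn : forall x, min_half_width M <= x -> x <= 1 -> x != g -> Rfun M q g < Rfun M q x.
Hypothesis cost_le : \int[mu]_(x in oo11) drag (p x) <= Rfun M q g.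

Let t := M / (1 - g).
Let c := q * g.
Let t1 : 1 <= t. Proof. exact: side_slope_ge1. Qed.
Let g0 : 0 <= g. Proof. exact: profile_g0 gg. Qed.
Let c0 : 0 <= c. Proof. exact: mulr_ge0. Qed.
Let ct : c < t.
Proof.
apply: lt_le_trans t1; apply: (@le_lt_trans _ _ g) => //.
by rewrite /c -[leRHS]mul1r ler_wpM2r.
Qed.
Let tg : t * (1 - g) = M. Proof. exact: side_slopeE. Qed.

Let rate x y : -1 < x -> x <= y -> y < 1 -> p y - p x <= q * (y - x).
Proof. exact: (sel_rate up). Qed.

Let noint a b : -1 <= a -> a < b -> b <= 1 ->
  exists2 z, a < z < b & ~ (c < `|p z| /\ `|p z| != t).
Proof. exact: (no_bad_interval M0 q0 up uM gg g1 gmn cost_le). Qed.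

Let p' z := - p (- z).
Let up' : slope_sel q (u \o -%R) p'. Proof. exact: reflect_sel. Qed.
Let uM' x : -1 <= x <= 1 -> 0 <= (u \o -%R) x <= M.
Proof. by move=> x11; apply: uM; lra. Qed.

Let rate' x y : -1 < x -> x <= y -> y < 1 -> p' y - p' x <= q * (y - x).
Proof. exact: (sel_rate up'). Qed.

Let noint' a b : -1 <= a -> a < b -> b <= 1 ->
  exists2 z, a < z < b & ~ (c < `|p' z| /\ `|p' z| != t).
Proof.
move=> a1 ab b1; have [|||z zab H] := @noint (- b) (- a); [lra|lra|lra|].
by exists (- z); [lra|rewrite /p' opprK normrN].
Qed.

(** By [no_crossing] the points with slope above [c] form an initial interval and, by reflection,
    those with slope below [- c] a final one. The flat set fills the gap, so the gap has length
    [2 * g]. *)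
Lemma slope_regions : [/\ forall z, -1 < z < - g -> p z = t,
  forall z, g < z < 1 -> p z = - t & forall z, - g < z < g -> `|p z| <= c].
Proof.
(* The end points -1 and 1 are included so that the supremum and the infimum make sense when there
   are no steep slopes. *)
pose A := [set x | -1 <= x < 1 /\ (x = -1 \/ c < p x)].
pose B := [set x | -1 < x <= 1 /\ (x = 1 \/ p x < - c)].
have A1 : A (-1) by split; [rewrite lexx; lra|left].
have B1 : B 1 by split; [rewrite lexx; lra|left].
have A0 : A !=set0 by exists (-1).
have B0 : B !=set0 by exists 1.
have ubA : has_ubound A by exists 1 => x [/andP[_ /ltW]].
have lbB : has_lbound B by exists (-1) => x [/andP[/ltW]].
pose a := sup A; pose b := inf B.
have a1 : -1 <= a by exact: ub_le_sup.
have b1 : b <= 1 by exact: ge_inf.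
have a2 : a <= 1 by apply: ge_sup => // x [/andP[_ /ltW]].
have b2 : -1 <= b by apply: lb_le_inf => // x [/andP[/ltW]].
have left z : -1 < z < a -> c < p z.
  move=> /andP[z1 za].
  have az0 : 0 < a - z by rewrite subr_gt0.
  have [x [/andP[x1 x2] Ax] zx] := sup_adherent az0 (conj A0 ubA).
  rewrite -/a subKr in zx.
  have xz : z <= x by exact: ltW.
  apply: (no_crossing q0 c0 ct rate noint z1 xz x2).
  by case: Ax => // xm1; move: zx; rewrite xm1 ltNge (ltW z1).
have right z : b < z < 1 -> p z < - c.
  move=> /andP[bz z1].
  have zb0 : 0 < z - b by rewrite subr_gt0.
  have [x [/andP[x1 x2] Bx] zx] := inf_adherent zb0 (conj B0 lbB).
  rewrite -/b addrC subrK in zx.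
  have := @no_crossing _ q p' c t q0 c0 ct rate' noint' (- z) (- x).
  rewrite /p' !opprK => H.
  have : c < - p z; last by lra.
  apply: H; [lra|lra|lra|].
  by case: Bx => [x1'|]; [move: zx; rewrite x1' ltNge (ltW z1)|lra].
have mid z : a < z < b -> `|p z| <= c.
  move=> /andP[az zb]; rewrite ler_norml; apply/andP; split; rewrite leNgt; apply/negP => H.
    have Bz : B z by split; [apply/andP; split; lra|right].
    by have := ge_inf lbB Bz; rewrite leNgt zb.
  have Az : A z by split; [apply/andP; split; lra|right].
  by have := ub_le_sup ubA Az; rewrite leNgt az.
have ab : a <= b.
  rewrite leNgt; apply/negP => ba.
  have m1 : -1 < (a + b) / 2 < a by lra.
  have m2 : b < (a + b) / 2 < 1 by lra.
  by have := left _ m1; have := right _ m2; have := c0; lra.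
have [flatg _] := msr_flat M0 q0 q1 up uM gg g1 gmn cost_le.
have ba : b - a = 2 * g.
  have fE : flat q g p `<=` `[a, b].
    move=> x [/= ]; rewrite /oo11 /= in_itv/= => /andP[x1 x2] px.
    rewrite in_itv/= !leNgt; apply/andP; split; apply/negP => h.
      have xa : -1 < x < a by rewrite x1.
      by have := left x xa; move: px; rewrite ler_norml => /andP[_]; rewrite leNgt => /negbTE ->.
    have bx : b < x < 1 by rewrite h.
    by have := right x bx; move: px; rewrite ler_norml => /andP[+ _]; rewrite leNgt => /negbTE ->.
  have Ef : `]a, b[ `<=` flat q g p.
    move=> x /=; rewrite in_itv/= => xab; split; last exact: mid.
    by rewrite /oo11 /= in_itv/=; lra.
  have fin (i : interval R) : [set` i] `<=` `[(-1)%R, 1%R] -> mu [set` i] \is a fin_num.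
    move=> ii; rewrite ge0_fin_numE//.
    apply: (@le_lt_trans _ _ (mu `[(-1)%R, 1%R])).
      by apply: le_measure; rewrite ?inE//; exact: measurable_itv.
    by rewrite lebesgue_measure_itv/=; case: ifPn => _; rewrite ltry.
  have f11 : flat q g p `<=` oo11 by move=> x [].
  have mf : measurable (flat q g p).
    exact: (measurable_flat g up).
  rewrite -flatg; apply/eqP; rewrite eq_le; apply/andP; split.
    rewrite -(@msr_itv _ false true a b)//; apply: msr_le => //.
  rewrite -(@msr_itv _ true false a b)//; apply: fine_le.
  - exact: mu_sub_fin.
  - by apply: fin => x /=; rewrite !in_itv/=; lra.
  - by apply: le_measure; rewrite ?inE//; exact: measurable_itv.
have pL z : -1 < z < a -> p z = t.
  exact: (@slope_const _ q p c t (-1) a q0 c0 (lexx _) a2 rate noint left).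
have pR z : -1 < z < - b -> p' z = t.
  have b1' : - b <= 1 by lra.
  apply: (@slope_const _ q p' c t (-1) (- b) q0 c0 (lexx _) b1' rate' noint').
  by move=> w wb; rewrite /p'; have := right (- w); lra.
(* The height bound gives [a <= - g] and [g <= b]; with [b - a = 2 * g] both are equalities. *)
have ag : a <= - g by apply: (left_end up uM g0 g1 t1 tg a2 pL).
have b1' : - b <= 1 by lra.
have bg : - b <= - g by apply: (left_end up' uM' g0 g1 t1 tg b1' pR).
have aE : a = - g by lra.
have bE : b = g by lra.
split.
- by move=> z zg; apply: pL; lra.
- move=> z zg; have zb : -1 < - z < - b by lra.
  by rewrite -(pR _ zb) /p' !opprK.
- by move=> z zg; apply: mid; lra.
Qed.

Lemma unique_left x : -1 <= x <= - g -> u x = t * (1 + x).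
Proof.
have [pL _ _] := slope_regions.
exact: (left_side q0 q1 up uM g0 g1 t1 tg pL).
Qed.

Lemma unique_right x : g <= x <= 1 -> u x = t * (1 - x).
Proof.
have [_ pR _] := slope_regions => xg.
have pR' z : -1 < z < - g -> p' z = t.
  by move=> zg; rewrite /p' pR ?opprK//; lra.
have := left_side q0 q1 up' uM' g0 g1 t1 tg pR' (_ : -1 <= - x <= - g).
by rewrite /= opprK; apply; lra.
Qed.

(** From below, [u - q / 2 * x^2] lies above its chord between [- g] and [g], where [u = M]. From
    above, an almost extremal slope in the valley is fed to [parabola_upper], with an error [4 * d]
    that tends to 0. *)
Lemma unique_mid x : - g < x < g -> u x = q / 2 * (x ^+ 2 - g ^+ 2) + M.
Proof.
move=> /andP[gx xg].
have ug : u g = M by rewrite unique_right ?tg// lexx ltW.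
have uNg : u (- g) = M by rewrite unique_left ?tg// lexx andbT lerN2 ltW.
have uleM z : -1 <= z <= 1 -> u z <= M by move=> /uM /andP[].
have gp : 0 < g by lra.
have g1' := g1; have q1' := q1.
apply/eqP; rewrite eq_le; apply/andP; split; last first.
  have := q_concave_chord (slope_sel_q_concave up) (_ : -1 <= - g) gx xg (ltW g1).
  rewrite ug uNg sqrrN => H.
  have {}H : (g - x) * (M - q / 2 * g ^+ 2) + (x - - g) * (M - q / 2 * g ^+ 2) <=
      (g - - g) * (u x - q / 2 * x ^+ 2) by apply: H; lra.
  have : (2 * g) * (M - q / 2 * g ^+ 2) <= (2 * g) * (u x - q / 2 * x ^+ 2) by lra.
  by rewrite ler_pM2l; lra.
have [q00|qn0] := eqVneq q 0; first by rewrite q00 mul0r mul0r add0r; apply: uleM; lra.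
have qp : 0 < q by rewrite lt_neqAle eq_sym qn0.
apply: (@le_small _ _ _ 4 (Num.min ((x + g) / 2) ((g - x) / 2))).
  by rewrite lt_min; lra.
move=> d d0; rewrite lt_min => /andP[dx1 dx2].
(* If all slopes in the valley were at most [q * (g - d)], [valley_cost] at [g - d] would make the
   valley cost more than [parabola_cost q g], since [drag (q * w)] decreases in [w >= 0]. *)
have [x0 Vx0 px0] : exists2 x0, valley u x0 & q * (g - d) < `|p x0|.
  apply: contrapT => H.
  have Vg : msr (valley u) = 2 * g.
    by have [_ /(_ cost_le)[_ [//|[qq _ _]]]] := cost_bound M0 q0 up uM gg g1 gmn; rewrite qq eqxx in qn0.
  have [_ /(_ Vg) cV] := msr_flat M0 q0 q1 up uM gg g1 gmn cost_le.
  have gd0 : 0 <= g - d by lra.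
  have gdV : 2 * (g - d) <= msr (valley u) by rewrite Vg; lra.
  have pV z : valley u z -> `|p z| <= q * (g - d).
    by move=> Vz; rewrite leNgt; apply/negP => pz; apply: H; exists z.
  have := le_trans (valley_cost q0 up gd0 gdV pV) cV.
  rewrite Vg; have [|w /andP[w1 w2] E] := @parabola_cost_mvt _ q (g - d) g q0; first lra.
  have : drag (q * w) < drag (q * (g - d)).
    rewrite drag_lt !ger0_norm ?mulr_ge0//; [by rewrite ltr_pM2l|lra].
  move=> n1 H1; have : (drag (q * (g - d)) - drag (q * w)) * d <= 0 by lra.
  by rewrite pmulr_lle0// subr_le0 leNgt n1.
have x011 : -1 < x0 < 1 := valley_sub Vx0.
have ux0 : u x0 < M.
  have [[_ [w [w1 w2 w3]]] _] := Vx0.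
  by apply: lt_le_trans w3 _; apply: uleM; lra.
(* On the sides the slope is [t], too steep for the valley; at [- g] and [g] the value is [M], too
   high for it. *)
have x0g : - g < x0 < g.
  have [pL pR _] := slope_regions.
  have ptV : `|p x0| < t.
    have Vb := valley_slope q0 up Vx0.
    apply: le_lt_trans ct; rewrite -(ler_pM2l (ltr0n R 2)); apply: le_trans Vb _.
    rewrite mulrCA /c; apply: ler_wpM2l => //.
    have [_ /(_ cost_le)[_ [->//|[_ _ V0]]]] := cost_bound M0 q0 up uM gg g1 gmn.
    by move: Vx0; rewrite V0.
  apply/andP; split; rewrite ltNge; apply/negP => h.
    move: h; rewrite le_eqVlt => /predU1P[x0E|x0l].
      by move: ux0; rewrite x0E uNg ltxx.
    have xl : -1 < x0 < - g by lra.
    by move: ptV; rewrite (pL _ xl) ger0_norm ?ltxx// (le_trans ler01).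
  move: h; rewrite le_eqVlt => /predU1P[x0E|x0l].
    by move: ux0; rewrite -x0E ug ltxx.
  have xr : g < x0 < 1 by lra.
  by move: ptV; rewrite (pR _ xr) normrN ger0_norm ?ltxx// (le_trans ler01).
have /andP[x01 x02] := x0g.
rewrite [q / 2 * _ + M + _](_ : _ = q / 2 * (x ^+ 2 - g ^+ 2) + M + 4 * d)//.
move: px0; rewrite lter_normr => /orP[px0|px0].
  have := @parabola_upper _ q (u \o -%R) p' M g d (- x0) (- x) qp q1 g0 g1 up'.
  rewrite /p' /= !opprK sqrrN; apply => //; lra.
by apply: (@parabola_upper _ q u p M g d x0 x) => //; lra.
Qed.

Lemma unique_profile x : -1 <= x <= 1 -> u x = profile q M g x.
Proof.
move=> /andP[x1 x2].
have x11 : `|x| <= 1 by rewrite ler_norml x1.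
have [xg|xg] := ltP `|x| g.
  rewrite (profile_mid q0 gg g1 (ltW xg))//; apply: unique_mid.
  by move: xg; rewrite ltr_norml.
rewrite profile_side//; have [x0|x0] := leP 0 x.
  by rewrite ger0_norm// in xg *; apply: unique_right; rewrite xg.
rewrite ltr0_norm// in xg *; rewrite opprK; apply: unique_left.
by rewrite x1; lra.
Qed.

End uniqueness.

(** It extends the strict minimality to all of [0, 1]. For [x < 1 - M] the side slope is below 1,
    where [drag] is strictly above its tangent at 1, and [parabola_cost] grows at rate at most 2. *)
Lemma Rfun_flat_lt {R : realType} (M q x : R) : 0 < M -> 0 <= q -> M < 1 ->
  0 <= x -> x < 1 - M -> Rfun M q (1 - M) < Rfun M q x.
Proof.
move=> M0 q0 M1 x0 xM.
have x1 : x < 1 by lra.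
have [c _ E] := parabola_cost_mvt q0 xM.
have nfc : drag (q * c) * (1 - M - x) <= 1 - M - x.
  by rewrite ler_piMl ?drag_le1// subr_ge0 ltW.
have R1 : Rfun M q (1 - M) = parabola_cost q (1 - M) + M.
  rewrite Rfun_drag//; last lra.
  by rewrite subKr divff ?gt_eqF// drag1; congr (_ + _); field.
pose s := M / (1 - x).
have s0 : 0 < s by rewrite divr_gt0// subr_gt0.
have s1 : s < 1 by rewrite ltr_pdivrMr ?subr_gt0// mul1r; lra.
have sM : s * (1 - x) = M by rewrite divfK// gt_eqF// subr_gt0.
have nfs : 1 - s / 2 < drag s.
  have i1 : tan_icpt 1 = 1 :> R by rewrite /tan_icpt expr1n; field.
  have k1 : tan_slope 1 = 1 / 2 :> R by rewrite /tan_slope expr1n; field.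
  have := @drag_tangent_le _ s 1 (lexx _) (ltW s0); rewrite i1 k1 le_eqVlt => /predU1P[H|]; last lra.
  have [] := @drag_tangent_eq _ s 1 (lexx _) (ltW s0); first by rewrite i1 k1 -H.
    by move=> sE; rewrite sE ltxx in s1.
  by move=> sE; rewrite sE ltxx in s0.
rewrite R1 Rfun_drag// -/s.
have H : (1 - x) * (1 - s / 2) < (1 - x) * drag s by rewrite ltr_pM2l// subr_gt0.
lra.
Qed.

Theorem theorem2p1 (R : realType) (M q : R)
    (M_gt0 : 0 < M) (q01 : 0 <= q <= 1) (q_le2M : q <= 2 * M) :
  exists u : R -> R,
    [/\ minimizer (K M q) (@resistance R) u,
        forall v : R -> R, minimizer (K M q) (@resistance R) v ->
          forall x : R, -1 <= x <= 1 -> v x = u x,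
        1 <= M -> forall x : R, -1 <= x <= 1 -> u x = M * (1 - `|x|)
      & M < 1 -> exists gamma : R,
          [/\ 0 < gamma < 1,
              unique (minimizer `[0, 1] (Rfun M q)) gamma,
              forall x : R, `|x| <= gamma ->
                u x = q / 2 * (x ^+ 2 - gamma ^+ 2) + M
            & forall x : R, gamma <= `|x| <= 1 ->
                u x = M / (1 - gamma) * (1 - `|x|)]].
Proof.
have /andP[q0 q1] := q01.
have [g [gg g1 gM1 gmn]] := Rfun_strict_min M_gt0 q0 q1.
have uK := profile_K q0 q_le2M gg g1.
have uR := profile_resistance M_gt0 q0 gg g1.
exists (profile q M g); split.
- split; first exact: uK.
  move=> v [vM vq].
  have [p vp] := slope_sel_exists vq.
  rewrite uR (resistance_sel q0 vp) lee_fin.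
  by have [] := cost_bound M_gt0 q0 vp vM gg g1 gmn.
- move=> v [[vM vq] vmin] x x11.
  have [p vp] := slope_sel_exists vq.
  apply: (unique_profile M_gt0 q0 q1 vp vM gg g1 gmn) => //.
  by have := vmin _ uK; rewrite uR (resistance_sel q0 vp) lee_fin.
- move=> M1 x /andP[x1 x2]; have g0 := gM1 M1.
  by rewrite profile_side// ?g0 ?subr0 ?divr1// ler_norml x1.
move=> M1; have gE : min_half_width M = 1 - M by apply/max_idPr; lra.
have g0 : 0 < g by rewrite gE in gg; lra.
have min_half_width_all x : 0 <= x -> x <= 1 -> x != g -> Rfun M q g < Rfun M q x.
  move=> x0 x1 xg; have [xM|xM] := ltP x (1 - M); last by apply: gmn; rewrite ?gE.
  apply: le_lt_trans (Rfun_flat_lt M_gt0 q0 M1 x0 xM).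
  by have [->//|gn] := eqVneq (1 - M) g; apply/ltW/gmn; rewrite ?gE//; lra.
exists g; split.
- by rewrite g0.
- split.
    split; first by rewrite /= in_itv/= !ltW.
    move=> y; rewrite /= in_itv/= => /andP[y0 y1].
    by have [->|yg] := eqVneq y g; [exact: lexx|exact/ltW/min_half_width_all].
  move=> y [/= + ymin]; rewrite in_itv/= => /andP[y0 y1].
  apply/eqP; apply: contraT => gy.
  have := min_half_width_all y y0 y1; rewrite eq_sym => /(_ gy); rewrite ltNge => /negP[].
  by apply: ymin; rewrite /= in_itv/= !ltW.
- by move=> x xg; apply: profile_mid.
- by move=> x /andP[gx x1]; apply: profile_side.
Qed.
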